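(* For any $r\in C^1[-1,1]$ with $r>0$ on $[-1,1]$, there exists $\gamma=\gamma(r)\in(0,1]$ such that if $\boldsymbol\alpha=(\alpha^-,\alpha^+)\in\mathcal A_\gamma$ then the spectrum $\sigma$ of the problem $$-u''=\lambda r u\ \text{ on }(-1,1),\qquad u(\pm1)=\sum_{i=1}^{m^\pm}\alpha_i^\pm u(\eta_i^\pm),$$ consists of a strictly increasing sequence of simple eigenvalues $\lambda_k=\lambda_k(r)>0$, $k=1,2,\dots$. Each eigenvalue $\lambda_k$ has an eigenfunction $u_k\in T_k^+$. In addition, $\lim_{k\to\infty}\lambda_k=\infty$.
   Context: Integers $m^\pm\ge1$ and points $\eta_i^\pm\in[-1,1]$, $i=1,\dots,m^\pm$, with $\eta_i^+\ne1$, $\eta_i^-\ne-1$, are fixed. The coefficients are $\alpha^\pm=(\alpha_1^\pm,\dots,\alpha_{m^\pm}^\pm)\in\mathbb R^{m^\pm}$, $\boldsymbol\alpha=(\alpha^-,\alpha^+)$. For $\alpha\in\mathbb R^m$, $|\alpha|:=\sum_{i=1}^m|\alpha_i|$. For $\gamma>0$, $\mathcal A_\gamma:=\{\boldsymbol\alpha:|\alpha^-|<\gamma\text{ and }|\alpha^+|<\gamma\}$. An eigenvalue is a number $\lambda\in\mathbb R$ for which the problem has a non-trivial solution $u$ (an eigenfunction); the spectrum $\sigma$ is the set of eigenvalues. $X:=\{u\in C^2[-1,1]: u(\pm1)=\sum_{i=1}^{m^\pm}\alpha_i^\pm u(\eta_i^\pm)\}$ (both boundary conditions hold), with the $C^2$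 norm; $Y:=C^0[-1,1]$ with the sup norm; $\Delta:X\to Y$, $\Delta u:=u''$. It is known that if $|\alpha^\pm|<1$ then $\Delta$ is bijective with continuous inverse, and $\Delta^{-1}:Y\to C^1[-1,1]$ is compact. Hence $K_r:Y\to Y$, $K_ru:=-\Delta^{-1}(ru)$, is a compact linear operator and $\lambda$ is an eigenvalue iff $u=\lambda K_ru$ has a non-trivial solution. The algebraic multiplicity of an eigenvalue $\lambda$ is $\dim\bigcup_{l\ge1}N((I_Y-\lambda K_r)^l)$ ($N$ = null-space); $\lambda$ is simple if its algebraic multiplicity is $1$. For $k\ge1$ and $\nu\in\{+,-\}$, $T_k^\nu\subset X$ is the set of $u\in X$ such that: (a) $u'(\pm1)\ne0$ and $\nu u'(-1)>0$; (b) $u'$ has only simple zeros in $(-1,1)$ (i.e. $u''\neq 0$ at each such zero), and has exactly $k$ such zeros; (c) $u$ has a zero strictly between each pair of consecutive zeros of $u'$. *)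

(* Defs.v *)
From Stdlib Require Import Reals List ClassicalEpsilon.
From Coquelicot Require Import Coquelicot.

Open Scope R_scope.

(** A function on [-1,1] is represented by a function [R -> R]; only its
    values on [-1,1] matter.  In particular derivatives are taken along
    [-1,1], hence are one-sided at the endpoints. *)

Definition Icc (x : R) : Prop := -1 <= x <= 1.
Definition Ioo (x : R) : Prop := -1 < x < 1.

(** [is_derive] with [locally x] replaced by the neighbourhoods of [x]
    in [-1,1]. *)
Definition is_derive_Icc (f : R -> R) (x l : R) : Prop :=
  filterdiff (K := R_AbsRing) (U := R_NormedModule) (V := R_NormedModule)
    f (within Icc (locally x)) (fun h => scal h l).

Definition is_derivative (f f' : R -> R) : Prop :=
  forall x, Icc x -> is_derive_Icc f x (f' x).

Definition C0_Icc (f : R -> R) : Prop := continuous_on Icc f.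

Definition C1_Icc (f : R -> R) : Prop := exists f', is_derivative f f' /\ C0_Icc f'.

Definition C2_Icc (u u' u'' : R -> R) : Prop :=
  is_derivative u u' /\ is_derivative u' u'' /\ C0_Icc u''.

Inductive pm : Set := Minus | Plus.

Definition pmR (s : pm) : R := match s with Minus => -1 | Plus => 1 end.

(** Vectors of [R^n] are maps [nat -> R] of which only the entries with
    index [1], ..., [n] are ever used. *)
Definition norm1 (n : nat) (a : nat -> R) : R :=
  sum_n_m (fun i => Rabs (a i)) 1 n.

Definition admissible_points (m : pm -> nat) (eta : pm -> nat -> R) : Prop :=
  forall s i, (1 <= i <= m s)%nat -> Icc (eta s i) /\ eta s i <> pmR s.

Definition calA (m : pm -> nat) (gamma : R) (alpha : pm -> nat -> R) : Prop :=
  forall s, norm1 (m s) (alpha s) < gamma.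

Definition boundary_conditions (m : pm -> nat) (eta alpha : pm -> nat -> R)
    (u : R -> R) : Prop :=
  forall s, u (pmR s) = sum_n_m (fun i => alpha s i * u (eta s i)) 1 (m s).

(** [u] belongs to [X], with first and second derivatives [u'] and [u'']. *)
Definition X_with (m : pm -> nat) (eta alpha : pm -> nat -> R)
    (u u' u'' : R -> R) : Prop :=
  C2_Icc u u' u'' /\ boundary_conditions m eta alpha u.

Definition eigenfunction (m : pm -> nat) (eta alpha : pm -> nat -> R)
    (r : R -> R) (lambda : R) (u : R -> R) : Prop :=
  (exists u' u'', X_with m eta alpha u u' u'' /\
     forall x, Ioo x -> - u'' x = lambda * r x * u x) /\
  exists x, Icc x /\ u x <> 0.

Definition spectrum (m : pm -> nat) (eta alpha : pm -> nat -> R)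
    (r : R -> R) (lambda : R) : Prop :=
  exists u, eigenfunction m eta alpha r lambda u.

(** The inverse of the operator [Delta u = u''] from [X] to the continuous
    functions on [-1,1], a bijection if [norm1 (m s) (alpha s) < 1] for both
    signs; the chosen [u] is then unique on [-1,1]. *)
Definition Delta_inv (m : pm -> nat) (eta alpha : pm -> nat -> R)
    (h : R -> R) : R -> R :=
  epsilon (inhabits (fun _ : R => 0))
    (fun u => exists u', X_with m eta alpha u u' h).

Definition K_op (m : pm -> nat) (eta alpha : pm -> nat -> R)
    (r u : R -> R) : R -> R :=
  fun x => - Delta_inv m eta alpha (fun t => r t * u t) x.

Definition I_minus_K (m : pm -> nat) (eta alpha : pm -> nat -> R)
    (r : R -> R) (lambda : R) (u : R -> R) : R -> R :=
  fun x => u x - lambda * K_op m eta alpha r u x.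

Definition generalized_nullspace (m : pm -> nat) (eta alpha : pm -> nat -> R)
    (r : R -> R) (lambda : R) (u : R -> R) : Prop :=
  C0_Icc u /\ exists l : nat, (1 <= l)%nat /\
    forall x, Icc x ->
      Nat.iter l (I_minus_K m eta alpha r lambda) u x = 0.

(** The linear subspace [V] of functions on [-1,1] has a basis
    [e 1], ..., [e n]. *)
Definition has_dim (V : (R -> R) -> Prop) (n : nat) : Prop :=
  exists e : nat -> R -> R,
    (forall i, (1 <= i <= n)%nat -> V (e i)) /\
    (forall c : nat -> R,
       (forall x, Icc x -> sum_n_m (fun i => c i * e i x) 1 n = 0) ->
       forall i, (1 <= i <= n)%nat -> c i = 0) /\
    (forall u, V u -> exists c : nat -> R,
       forall x, Icc x -> u x = sum_n_m (fun i => c i * e i x) 1 n).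

Definition algebraic_multiplicity (m : pm -> nat) (eta alpha : pm -> nat -> R)
    (r : R -> R) (lambda : R) (n : nat) : Prop :=
  has_dim (generalized_nullspace m eta alpha r lambda) n.

Definition simple_eigenvalue (m : pm -> nat) (eta alpha : pm -> nat -> R)
    (r : R -> R) (lambda : R) : Prop :=
  spectrum m eta alpha r lambda /\
  algebraic_multiplicity m eta alpha r lambda 1.

Definition T_set (m : pm -> nat) (eta alpha : pm -> nat -> R)
    (k : nat) (nu : pm) (u : R -> R) : Prop :=
  exists u' u'', X_with m eta alpha u u' u'' /\
    ((forall s, u' (pmR s) <> 0) /\ pmR nu * u' (-1) > 0) /\
    ((forall x, Ioo x -> u' x = 0 -> u'' x <> 0) /\
     exists zs : list R, NoDup zs /\ length zs = k /\
       forall x, In x zs <-> Ioo x /\ u' x = 0) /\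
    (forall x y, Ioo x -> Ioo y -> x < y -> u' x = 0 -> u' y = 0 ->
       (forall z, x < z < y -> u' z <> 0) ->
       exists z, x < z < y /\ u z = 0).

(* Main.v *)
Require Import Defs.
From Stdlib Require Import Reals List ZArith Lra Lia Psatz ClassicalEpsilon.
From Coquelicot Require Import Coquelicot.

Open Scope R_scope.

(** Write lambda = s^2 and r = p^2, where p' = q p.  In the Pruefer variables
    u = exp rho * sin th,  u' = s p exp rho * cos th  the equation
    -u'' = lambda r u becomes
      th' = s p + q sin th cos th,    rho' = - q (cos th)^2,
    for every real s.  The terms carrying q do not contain s, so all estimates
    below are uniform in s, and this is what makes one threshold on the
    coefficients work for all eigenvalues at once.

    - The amplitude exp rho varies by a bounded factor only.  Hence small
      coefficients turn a nonlocal condition at an endpoint into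
      |sin th| <= 1/2 there: the solution is close to a Dirichlet solution,
      and th(1) lies in one of the disjoint intervals |th(1) - k PI| < PI/2.
    - The difference w of two angles, with parameters s1 <= s2, satisfies
      |w' - (s2 - s1) p| <= Q |w|.  So w is at most of the size of
      |w(-1)| + (s2 - s1), and if w(-1) is small compared with s2 - s1 then
      w(1) is at least a fixed multiple of s2 - s1 ([forced_bound],
      [forced_gain]).  On the other hand, when both solutions satisfy the
      boundary condition at an endpoint with the same index k, the value of w
      at that endpoint is small compared with |w(-1)| + (s2 - s1)
      ([angle_end_difference]).  At both endpoints at once this is only
      possible when s1 = s2 ([forced_rigidity]), so there is at most one
      parameter for each k.
    - For each s exactly one initial angle in (-PI/2, PI/2) meets the left
      condition.  The resulting end angle th(1) is a continuous, strictly
      increasing and onto function of s, vanishing at s = 0, and between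
      k PI - PI/2 and k PI + PI/2 the right condition changes sign: this
      produces the k-th parameter ([eigenmode_exists]).  The index k = 0
      belongs to s = 0 and is not an eigenvalue; for lambda <= 0 the function
      u^2 is convex, hence bounded by its boundary values, and the boundary
      conditions make it vanish ([convex_solution_zero]).
    - A Jordan chain of length two at lambda = s^2 would be a solution of
      v'' = - s^2 r (v + c u) with c <> 0.  Written as
      v = exp rho (l sin th + w cos th), its component w obeys the inequality
      of the second item with c s / 2 instead of s2 - s1, and the boundary
      conditions give the same smallness; so the same rigidity yields c = 0
      and v = a u ([resonant_solution]).  This is algebraic simplicity.
    - u' vanishes exactly where cos th does, and there th' = s p > 0.  So th
      crosses each odd multiple of PI/2 at most once and upwards, and from the
      values at the endpoints there are exactly k crossings
      ([eigenmode_critical_points]).  Between two zeros of u', Rolle's theorem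
      gives a zero of u'' = - lambda r u, that is, of u. *)

(** * Calculus on the closed interval *)

(** Composing with this retraction onto the interval turns one-sided
    continuity at the endpoints into ordinary continuity on the line. *)
Definition clamp (x : R) : R := Rmax (-1) (Rmin 1 x).

Lemma clamp_Icc x : Icc (clamp x).
Proof. unfold Icc, clamp, Rmax, Rmin; repeat destruct Rle_dec; lra. Qed.

Lemma clamp_id x : Icc x -> clamp x = x.
Proof. unfold Icc, clamp, Rmax, Rmin; repeat destruct Rle_dec; lra. Qed.

Lemma clamp_lipschitz x y : Rabs (clamp x - clamp y) <= Rabs (x - y).
Proof.
  unfold clamp, Rmax, Rmin, Rabs; repeat destruct Rle_dec;
    repeat destruct Rcase_abs; lra.
Qed.

Lemma lipschitz_continuous f C :
  (forall x y, Rabs (f x - f y) <= C * Rabs (x - y)) ->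
  forall x : R, continuous f x.
Proof.
  intros H x. apply filterlim_locally. intros eps.
  assert (HC : 0 < Rabs C + 1) by (pose proof (Rabs_pos C); lra).
  assert (Hd : 0 < eps / (Rabs C + 1)) by (apply Rdiv_lt_0_compat; [apply eps | lra]).
  exists (mkposreal _ Hd). intros y Hy.
  change (Rabs (y - x) < eps / (Rabs C + 1)) in Hy.
  change (Rabs (f y - f x) < eps).
  apply Rle_lt_trans with (1 := H y x).
  apply Rle_lt_trans with ((Rabs C + 1) * Rabs (y - x)).
  { apply Rmult_le_compat_r; [apply Rabs_pos|]. pose proof (Rle_abs C); lra. }
  apply Rlt_le_trans with ((Rabs C + 1) * (eps / (Rabs C + 1))).
  { apply Rmult_lt_compat_l; lra. }
  right; field; lra.
Qed.

Lemma clamp_continuous x : continuous clamp x.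
Proof.
  apply lipschitz_continuous with 1. intros a b.
  rewrite Rmult_1_l. apply clamp_lipschitz.
Qed.

Lemma C0_clamp_continuous f :
  C0_Icc f -> forall x, continuous (fun t => f (clamp t)) x.
Proof.
  intros H x. unfold continuous.
  apply filterlim_comp with (2 := H (clamp x) (clamp_Icc x)).
  intros P HP. unfold filtermap.
  pose proof (clamp_continuous x _ HP) as H1. unfold filtermap in H1.
  apply filter_imp with (2 := H1). intros y Hy. apply Hy, clamp_Icc.
Qed.

Lemma continuous_C0 f : (forall x, Icc x -> continuous f x) -> C0_Icc f.
Proof.
  intros H x Hx. apply filterlim_filter_le_1 with (2 := H x Hx).
  apply filter_le_within.
Qed.

Lemma C0_ext f g : (forall x, Icc x -> f x = g x) -> C0_Icc f -> C0_Icc g.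
Proof.
  intros E H x Hx. rewrite <- E by assumption.
  apply filterlim_within_ext with f; auto.
Qed.

Lemma within_Icc_interior x P :
  Ioo x -> within Icc (locally x) P -> locally x P.
Proof.
  intros Hx H. assert (HI : locally x Icc).
  { assert (Hd : 0 < Rmin (x + 1) (1 - x))
      by (unfold Ioo in Hx; apply Rmin_case; lra).
    exists (mkposreal _ Hd). intros y Hy.
    change (Rabs (y - x) < Rmin (x + 1) (1 - x)) in Hy.
    pose proof (Rmin_l (x + 1) (1 - x)). pose proof (Rmin_r (x + 1) (1 - x)).
    apply Rabs_def2 in Hy. unfold Icc; lra. }
  generalize (filter_and _ _ HI H). apply filter_imp. intros y [H1 H2]; auto.
Qed.

Lemma is_derive_Icc_interior f x l :
  Ioo x -> is_derive_Icc f x l -> is_derive f x l.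
Proof.
  intros Hx [Hl Hd]. split; [apply is_linear_scal_l|].
  intros y Hy eps.
  assert (Hy' : is_filter_lim (within Icc (locally x)) y).
  { intros P HP. apply filter_le_within. now apply Hy. }
  specialize (Hd y Hy' eps). now apply within_Icc_interior.
Qed.

(** The interval has no isolated point, so the neighbourhoods of a point of it
    within the interval have only that point as a limit. *)
Lemma is_derive_is_derive_Icc f x l :
  Icc x -> is_derive f x l -> is_derive_Icc f x l.
Proof.
  intros Hx [Hl Hd]. split; [apply Hl|].
  intros y Hy eps.
  assert (PF : ProperFilter' (within Icc (locally x))).
  { constructor; [|apply within_filter, locally_filter].
    intros H. apply (locally_singleton _ _ H Hx). }
  assert (E : y = x).
  { apply (is_filter_lim_unique (K := R_AbsRing) (V := R_NormedModule)
             (F := within Icc (locally x))); auto.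
    intros P HP. now apply filter_le_within. }
  subst y. apply filter_le_within. apply Hd. intros P HP; exact HP.
Qed.

Lemma is_derivative_C0 f f' : is_derivative f f' -> C0_Icc f.
Proof.
  intros H x Hx.
  apply (filterdiff_continuous_aux (K := R_AbsRing) (U := R_NormedModule)
     (V := R_NormedModule) (F := within Icc (locally x))).
  - eexists. apply H; assumption.
  - intros P HP. now apply filter_le_within.
Qed.

Lemma is_derive_continuous (f : R -> R) (x l : R) : is_derive f x l -> continuous f x.
Proof.
  intros H. exact (ex_derive_continuous f x (ex_intro _ l H)).
Qed.

Lemma MVT_Icc (f f' : R -> R) a b :
  -1 <= a -> a < b -> b <= 1 ->
  (forall x, continuous f x) ->
  (forall x, Ioo x -> is_derive f x (f' x)) ->
  exists c, a < c < b /\ f b - f a = f' c * (b - a).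
Proof.
  intros Ha Hab Hb Hc Hd.
  assert (pr : forall c, a < c < b -> derivable_pt f c).
  { intros c Hc'. exists (f' c). apply is_derive_Reals, Hd. unfold Ioo; lra. }
  destruct (MVT f id a b pr (fun c _ => derivable_pt_id c) Hab) as [c [Hc1 Hc2]].
  - intros c _. apply continuity_pt_filterlim, Hc.
  - intros c _. apply derivable_continuous, derivable_id.
  - exists c; split; [assumption|].
    rewrite (proj2 (derive_pt_eq _ _ (1) (derivable_pt_id c)) (derivable_pt_lim_id c)) in Hc2.
    rewrite (proj2 (derive_pt_eq _ _ (f' c) (pr c Hc1))) in Hc2.
    + unfold id in Hc2. lra.
    + apply is_derive_Reals, Hd. unfold Ioo; lra.
Qed.

Lemma eq_of_derivative (f g f' g' : R -> R) :
  (forall x, continuous f x) -> (forall x, continuous g x) ->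
  (forall x, Ioo x -> is_derive f x (f' x)) ->
  (forall x, Ioo x -> is_derive g x (g' x)) ->
  (forall x, Ioo x -> f' x = g' x) ->
  f (-1) = g (-1) -> forall x, Icc x -> f x = g x.
Proof.
  intros Cf Cg Df Dg E E0 x Hx.
  destruct (Req_dec x (-1)) as [->|Hn]; [assumption|].
  destruct (MVT_Icc (fun t => f t - g t) (fun t => f' t - g' t) (-1) x)
    as [c [Hc1 Hc2]]; unfold Icc in Hx; try lra.
  - intros t. apply (continuous_minus (V := R_NormedModule)); auto.
  - intros t Ht. apply (is_derive_minus (V := R_NormedModule)); auto.
  - rewrite E in Hc2 by (unfold Ioo; lra). lra.
Qed.

Lemma continuous_ex_RInt (h : R -> R) a b : (forall x, continuous h x) -> ex_RInt h a b.
Proof. intros H. apply (ex_RInt_continuous (V := R_CompleteNormedModule)). auto. Qed.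

Lemma is_derive_primitive (h : R -> R) (a c x : R) :
  (forall x, continuous h x) ->
  is_derive (fun y => c + RInt h a y) x (h x).
Proof.
  intros H. evar_last.
  - apply (is_derive_plus (V := R_NormedModule)).
    + apply (is_derive_const (V := R_NormedModule)).
    + apply (is_derive_RInt (V := R_NormedModule)) with (a := a); [|apply H].
      apply filter_forall. intros y.
      apply (RInt_correct (V := R_CompleteNormedModule)), continuous_ex_RInt, H.
  - apply plus_zero_l.
Qed.

Lemma primitive_at a c (h : R -> R) : c + RInt h a a = c.
Proof. rewrite RInt_point. change (c + 0 = c). ring. Qed.

(** The right-hand side is a function differentiable on the whole line; this is
    how one-sided derivatives are traded for two-sided ones. *)
Lemma primitive_of_derivative f f' :
  is_derivative f f' -> C0_Icc f' -> forall x, Icc x ->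
  f x = f (-1) + RInt (fun t => f' (clamp t)) (-1) x.
Proof.
  intros H C x Hx.
  rewrite <- (clamp_id x) at 1 by assumption.
  pose proof (C0_clamp_continuous f' C) as C'.
  apply (eq_of_derivative (fun t => f (clamp t))
           (fun t => f (-1) + RInt (fun t => f' (clamp t)) (-1) t)
           f' (fun t => f' (clamp t))); try assumption.
  - apply C0_clamp_continuous, (is_derivative_C0 _ _ H).
  - intros t. eapply is_derive_continuous, is_derive_primitive, C'.
  - intros t Ht.
    apply (is_derive_ext_loc (V := R_NormedModule) f).
    + apply within_Icc_interior; [assumption|].
      unfold within. apply filter_forall. intros y Hy. now rewrite clamp_id.
    + apply is_derive_Icc_interior; [assumption|].
      apply H. unfold Ioo in Ht; unfold Icc; lra.
  - intros t _. apply (is_derive_primitive (fun t => f' (clamp t))), C'.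
  - intros t Ht. rewrite clamp_id; [reflexivity|]. unfold Ioo in Ht; unfold Icc; lra.
  - rewrite primitive_at, clamp_id; [reflexivity|unfold Icc; lra].
Qed.

(** Integrating the clamped second derivative twice extends u beyond the
    interval, so that all later computations use ordinary derivatives. *)
Lemma C2_extension u u' u'' :
  C2_Icc u u' u'' -> exists U U',
    (forall x, is_derive U x (U' x)) /\
    (forall x, is_derive U' x (u'' (clamp x))) /\
    (forall x, Icc x -> U x = u x).
Proof.
  intros (H1 & H2 & H3).
  pose proof (C0_clamp_continuous _ H3) as C.
  set (U' := fun x => u' (-1) + RInt (fun t => u'' (clamp t)) (-1) x).
  assert (D' : forall x, is_derive U' x (u'' (clamp x))).
  { intros x. apply (is_derive_primitive (fun t => u'' (clamp t))), C. }
  assert (C' : forall x, continuous U' x).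
  { intros x. eapply is_derive_continuous, D'. }
  exists (fun x => u (-1) + RInt U' (-1) x), U'. split; [|split].
  - intros x. now apply is_derive_primitive.
  - assumption.
  - intros x Hx. rewrite (primitive_of_derivative u u' H1 (is_derivative_C0 _ _ H2) x Hx).
    f_equal. apply RInt_ext. intros t Ht.
    assert (It : Icc t).
    { unfold Icc in *. rewrite Rmin_left, Rmax_right in Ht by lra. lra. }
    rewrite clamp_id by assumption. symmetry.
    now apply primitive_of_derivative.
Qed.

Lemma C2_of_is_derive u u' u'' :
  (forall x, Icc x -> is_derive u x (u' x)) ->
  (forall x, Icc x -> is_derive u' x (u'' x)) ->
  C0_Icc u'' -> C2_Icc u u' u''.
Proof.
  intros H1 H2 H3. split; [|split; [|assumption]];
  intros x Hx; apply is_derive_is_derive_Icc; auto.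
Qed.

Lemma C0_bounded f : C0_Icc f -> exists B, 0 < B /\ forall x, Icc x -> Rabs (f x) <= B.
Proof.
  intros H.
  destruct (continuity_ab_maj (fun t => Rabs (f (clamp t))) (-1) 1) as [c [Hc _]].
  - lra.
  - intros c _. apply continuity_pt_filterlim.
    apply (continuous_comp (fun t => f (clamp t)) Rabs).
    + now apply C0_clamp_continuous.
    + apply continuity_pt_filterlim, Rcontinuity_abs.
  - exists (Rabs (f (clamp c)) + 1). split.
    + pose proof (Rabs_pos (f (clamp c))). lra.
    + intros x Hx. specialize (Hc x Hx). simpl in Hc.
      rewrite (clamp_id x) in Hc by assumption. lra.
Qed.

Lemma C0_mult f g : C0_Icc f -> C0_Icc g -> C0_Icc (fun x => f x * g x).
Proof.
  intros Hf Hg. apply C0_ext with (fun x => f (clamp x) * g (clamp x)).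
  - intros x Hx. now rewrite clamp_id.
  - apply continuous_C0. intros x _.
    apply (continuous_mult (K := R_AbsRing)); now apply C0_clamp_continuous.
Qed.

Lemma C0_minus_scal f g c : C0_Icc f -> C0_Icc g -> C0_Icc (fun x => f x - c * - g x).
Proof.
  intros Hf Hg. apply C0_ext with (fun x => f (clamp x) + c * g (clamp x)).
  - intros x Hx. rewrite clamp_id by assumption. ring.
  - apply continuous_C0. intros x _.
    apply (continuous_plus (V := R_NormedModule)); [now apply C0_clamp_continuous|].
    apply (continuous_mult (K := R_AbsRing)); [apply continuous_const|now apply C0_clamp_continuous].
Qed.

(** Used to carry the differential equation from the open interval to its
    endpoints. *)
Lemma C0_eq_of_interior f g :
  C0_Icc f -> C0_Icc g -> (forall x, Ioo x -> f x = g x) -> forall x, Icc x -> f x = g x.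
Proof.
  intros Cf Cg E x Hx.
  set (h := fun t => f (clamp t) - g (clamp t)).
  assert (Ch : forall t, continuous h t).
  { intros t. apply (continuous_minus (V := R_NormedModule)); now apply C0_clamp_continuous. }
  assert (Z : forall t, Ioo t -> h t = 0).
  { intros t Ht. unfold h. rewrite clamp_id by (unfold Ioo in Ht; unfold Icc; lra).
    rewrite E by assumption. ring. }
  assert (h x = 0); [|unfold h in H; rewrite clamp_id in H by assumption; lra].
  destruct (Req_dec (h x) 0) as [|Hn]; [assumption|exfalso].
  pose proof (Rabs_pos_lt _ Hn) as Hpos.
  destruct (proj1 (filterlim_locally h (h x)) (Ch x) (mkposreal _ Hpos)) as [d Hd].
  set (e := Rmin (d / 2) 1). assert (0 < d) by apply d.
  assert (0 < e) by (apply Rmin_case; lra).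
  assert (e <= d / 2) by apply Rmin_l. assert (e <= 1) by apply Rmin_r.
  set (t := x * (1 - e / 2)).
  assert (Ht : Ioo t) by (unfold Ioo, Icc, t in *; nra).
  assert (B : ball x d t).
  { change (Rabs (t - x) < d). unfold t. apply Rabs_def1; unfold Icc in Hx; nra. }
  specialize (Hd t B). change (Rabs (h t - h x) < Rabs (h x)) in Hd.
  rewrite (Z t Ht) in Hd. replace (0 - h x) with (- h x) in Hd by ring. rewrite Rabs_Ropp in Hd. lra.
Qed.

Lemma lipschitz_of_derivative (f f' : R -> R) K a b :
  (forall x, Rmin a b <= x <= Rmax a b -> is_derive f x (f' x)) ->
  (forall x, Rmin a b <= x <= Rmax a b -> Rabs (f' x) <= K) ->
  Rabs (f b - f a) <= K * Rabs (b - a).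
Proof.
  intros D B. destruct (MVT_gen f a b f') as [c [Hc ->]].
  - intros x Hx. apply D; lra.
  - intros x Hx. apply continuity_pt_filterlim. eapply is_derive_continuous, D, Hx.
  - rewrite Rabs_mult. apply Rmult_le_compat_r; [apply Rabs_pos|auto].
Qed.

Lemma lipschitz_Icc (f f' : R -> R) K a b :
  (forall x, Icc x -> is_derive f x (f' x)) ->
  (forall x, Icc x -> Rabs (f' x) <= K) ->
  Icc a -> Icc b -> Rabs (f b - f a) <= K * Rabs (b - a).
Proof.
  intros D B Ha Hb.
  assert (I : forall x, Rmin a b <= x <= Rmax a b -> Icc x).
  { unfold Icc, Rmin, Rmax in *; intros x; destruct Rle_dec; lra. }
  apply lipschitz_of_derivative with f'; auto.
Qed.

(** The eta-expanded form in which [auto_derive] leaves derivatives. *)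
Lemma derive_eq (f : R -> R) (x l : R) : is_derive f x l -> Derive (fun t : R => f t) x = l.
Proof. exact (is_derive_unique f x l). Qed.

(** * Comparison with explicit sub- and supersolutions *)

Lemma is_derive_pos_local (f : R -> R) (x l : R) :
  is_derive f x l -> 0 < l -> exists d, 0 < d /\
  forall t, Rabs (t - x) < d -> 0 <= (f t - f x) * (t - x) /\ (t <> x -> 0 < (f t - f x) * (t - x)).
Proof.
  intros H Hl. apply is_derive_Reals in H.
  destruct (H l Hl) as [d Hd].
  exists d. split; [apply d|]. intros t Ht.
  destruct (Req_dec t x) as [->|Hn]; [split; [nra|tauto]|].
  specialize (Hd (t - x) ltac:(lra) Ht).
  replace (x + (t - x)) with t in Hd by ring.
  apply Rabs_def2 in Hd.
  assert (0 < (f t - f x) / (t - x)) by lra.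
  assert (0 < (f t - f x) * (t - x)).
  { replace ((f t - f x) * (t - x)) with ((f t - f x) / (t - x) * ((t - x) * (t - x)))
      by (field; lra). apply Rmult_lt_0_compat; nra. }
  split; [lra|auto].
Qed.

(** At the last point before a negative value where f is nonnegative, f vanishes
    and would have to decrease.  With f the difference of a function and a
    barrier this compares solutions without solving any inequality for f'. *)
Lemma positive_of_crossing_upward (f f' : R -> R) a b :
  (forall x, a <= x <= b -> is_derive f x (f' x)) ->
  0 <= f a ->
  (forall x, a <= x <= b -> f x = 0 -> 0 < f' x) ->
  forall x, a < x <= b -> 0 < f x.
Proof.
  intros D Ha Up x1 Hx1.
  destruct (Rlt_le_dec 0 (f x1)) as [|Hneg]; [assumption|exfalso].
  assert (exists x2, a < x2 <= b /\ f x2 < 0) as [x2 [Hx2 Hf2]].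
  { destruct (Req_dec (f x1) 0) as [E|]; [|exists x1; split; lra].
    destruct (is_derive_pos_local f x1 (f' x1)) as [d [Hd Hloc]].
    { apply D; lra. } { apply Up; lra. }
    set (t := x1 - Rmin (d / 2) ((x1 - a) / 2)).
    assert (0 < Rmin (d / 2) ((x1 - a) / 2)) by (apply Rmin_case; lra).
    pose proof (Rmin_l (d / 2) ((x1 - a) / 2)).
    pose proof (Rmin_r (d / 2) ((x1 - a) / 2)).
    exists t. split; [unfold t; lra|].
    destruct (Hloc t) as [_ Ht]; [apply Rabs_def1; unfold t; lra|].
    specialize (Ht ltac:(unfold t; lra)).
    assert (t - x1 < 0) by (unfold t; lra). nra. }
  (* the supremum c is the last point before x2 where f is nonnegative *)
  set (P := fun t => a <= t <= x2 /\ 0 <= f t).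
  destruct (completeness P) as [c [Hub Hlub]].
  { exists x2. intros t [Ht _]; lra. }
  { exists a. split; lra. }
  assert (Hac : a <= c) by (apply Hub; split; lra).
  assert (Hcx : c <= x2) by (apply Hlub; intros t [Ht _]; lra).
  assert (Cc : continuous f c) by (eapply is_derive_continuous, D; lra).
  assert (Hloc : forall e, 0 < e -> exists d, 0 < d /\ forall t, Rabs (t - c) < d -> Rabs (f t - f c) < e).
  { intros e He. apply filterlim_locally with (eps := mkposreal e He) in Cc.
    destruct Cc as [d Hd]. exists d. split; [apply d|]. intros t Ht. apply (Hd t Ht). }
  destruct (Rtotal_order (f c) 0) as [Hc|[Hc|Hc]].
  - destruct (Hloc (- f c)) as [d [Hd Ht]]; [lra|].
    assert (c <= c - d); [|lra].
    apply Hlub. intros t [Ht1 Ht2].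
    destruct (Rle_lt_dec t (c - d)) as [|Hlt]; [assumption|].
    assert (t <= c) by (apply Hub; split; assumption).
    specialize (Ht t ltac:(apply Rabs_def1; lra)). apply Rabs_def2 in Ht. lra.
  - destruct (is_derive_pos_local f c (f' c)) as [d [Hd Hl]].
    { apply D; lra. } { apply Up; lra. }
    assert (c <> x2) by (intros ->; lra).
    set (t := c + Rmin (d / 2) (x2 - c)).
    assert (0 < Rmin (d / 2) (x2 - c)) by (apply Rmin_case; lra).
    pose proof (Rmin_l (d / 2) (x2 - c)). pose proof (Rmin_r (d / 2) (x2 - c)).
    destruct (Hl t) as [Ht _]; [apply Rabs_def1; unfold t; lra|].
    assert (t <= c); [|unfold t in *; lra].
    apply Hub. split; [unfold t; lra|].
    assert (0 < t - c) by (unfold t; lra). nra.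
  - destruct (Hloc (f c)) as [d [Hd Ht]]; [lra|].
    assert (c <> x2) by (intros ->; lra).
    set (t := c + Rmin (d / 2) (x2 - c)).
    assert (0 < Rmin (d / 2) (x2 - c)) by (apply Rmin_case; lra).
    pose proof (Rmin_l (d / 2) (x2 - c)). pose proof (Rmin_r (d / 2) (x2 - c)).
    specialize (Ht t ltac:(apply Rabs_def1; unfold t; lra)). apply Rabs_def2 in Ht.
    assert (t <= c); [|unfold t in *; lra].
    apply Hub. split; [unfold t|]; lra.
Qed.

Lemma exp_le_mono a b : a <= b -> exp a <= exp b.
Proof.
  intros [H| ->]; [left; now apply exp_increasing|lra].
Qed.

Lemma one_le_exp a : 0 <= a -> 1 <= exp a.
Proof. intros H. pose proof (exp_ineq1_le a). lra. Qed.

(** The barrier is K exp ((Q + 1) (x + 1)) with K slightly larger than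
    |w(-1)| + S: where w touches it, (Q + 1) w exceeds S + Q |w|. *)
Lemma gronwall_upper (w w' : R -> R) Q S :
  0 <= Q ->
  (forall x, Icc x -> is_derive w x (w' x)) ->
  (forall x, Icc x -> w' x <= S + Q * Rabs (w x)) ->
  0 <= S ->
  forall x, Icc x -> w x <= exp (2 * (Q + 1)) * (Rabs (w (-1)) + S).
Proof.
  intros HQ D B HS x Hx. apply le_epsilon. intros e He.
  set (E := exp (2 * (Q + 1))). assert (HE : 0 < E) by apply exp_pos.
  (* the excess e / E makes the comparison strict and costs at most e *)
  set (K := Rabs (w (-1)) + S + e / E).
  assert (HeE : 0 < e / E) by (apply Rdiv_lt_0_compat; lra).
  pose proof (Rabs_pos (w (-1))) as Hw0. pose proof (Rle_abs (w (-1))) as Hw1.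
  assert (HK : 0 < K) by (unfold K; lra).
  replace (E * (Rabs (w (-1)) + S) + e) with (K * E) by (unfold K; field; lra).
  assert (HX : K * exp ((Q + 1) * (x + 1)) <= K * E).
  { apply Rmult_le_compat_l; [lra|]. unfold E.
    apply exp_le_mono. unfold Icc in Hx. nra. }
  destruct (Req_dec x (-1)) as [->|Hn].
  { assert (1 <= E). { apply one_le_exp. lra. }
    assert (K <= K * E) by nra. unfold K in *. lra. }
  assert (0 < K * exp ((Q + 1) * (x + 1)) - w x); [|lra].
  apply (positive_of_crossing_upward
    (fun x => K * exp ((Q + 1) * (x + 1)) - w x)
    (fun x => K * ((Q + 1) * exp ((Q + 1) * (x + 1))) - w' x) (-1) 1).
  - intros t Ht. apply (is_derive_minus (V := R_NormedModule)); [|apply D; assumption].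
    auto_derive; [trivial|ring].
  - replace ((Q + 1) * (-1 + 1)) with 0 by ring. rewrite exp_0. unfold K; lra.
  - intros t Ht H0.
    assert (Hexp : 1 <= exp ((Q + 1) * (t + 1))).
    { apply one_le_exp. nra. }
    assert (Hwt : w t = K * exp ((Q + 1) * (t + 1))) by lra.
    assert (K <= w t) by nra.
    specialize (B t Ht). rewrite Rabs_pos_eq in B by lra.
    replace (K * ((Q + 1) * exp ((Q + 1) * (t + 1)))) with ((Q + 1) * w t)
      by (rewrite Hwt; ring).
    unfold K in *. lra.
  - unfold Icc in Hx. lra.
Qed.

Lemma gronwall (w w' : R -> R) Q S :
  0 <= Q -> 0 <= S ->
  (forall x, Icc x -> is_derive w x (w' x)) ->
  (forall x, Icc x -> Rabs (w' x) <= S + Q * Rabs (w x)) ->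
  forall x, Icc x -> Rabs (w x) <= exp (2 * (Q + 1)) * (Rabs (w (-1)) + S).
Proof.
  intros HQ HS D B x Hx. apply Rabs_le. split.
  - assert (- w x <= exp (2 * (Q + 1)) * (Rabs (- w (-1)) + S)).
    { apply (gronwall_upper (fun x => - w x) (fun x => - w' x) Q S); auto.
      - intros t Ht. apply (is_derive_opp (V := R_NormedModule)); auto.
      - intros t Ht. rewrite Rabs_Ropp. specialize (B t Ht).
        pose proof (Rle_abs (- w' t)). rewrite Rabs_Ropp in H. lra. }
    rewrite Rabs_Ropp in H. lra.
  - apply gronwall_upper with w' ; auto.
    intros t Ht. specialize (B t Ht). pose proof (Rle_abs (w' t)). lra.
Qed.

(** * Global solutions of a scalar Lipschitz equation *)

Lemma abs_RInt_le_bound (h : R -> R) a b M :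
  (forall x, continuous h x) -> (forall x, Rabs (h x) <= M) ->
  Rabs (RInt h a b) <= M * Rabs (b - a).
Proof.
  intros C B. destruct (Rle_dec a b) as [Hab|Hab].
  - rewrite (Rabs_pos_eq (b - a)), Rmult_comm by lra.
    apply abs_RInt_le_const; auto. now apply continuous_ex_RInt.
  - rewrite <- opp_RInt_swap by now apply continuous_ex_RInt.
    change (opp (RInt h b a)) with (- RInt h b a).
    rewrite Rabs_Ropp, (Rabs_left (b - a)), Rmult_comm by lra.
    replace (- (b - a)) with (a - b) by ring.
    apply abs_RInt_le_const; auto; [lra|]. now apply continuous_ex_RInt.
Qed.

Lemma RInt_sub_Chasles (h : R -> R) a b c :
  (forall x, continuous h x) -> RInt h a c - RInt h a b = RInt h b c.
Proof.
  intros C. rewrite <- (RInt_Chasles h a b c) by now apply continuous_ex_RInt.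
  change plus with Rplus. lra.
Qed.

Lemma RInt_sub (g h : R -> R) a b :
  (forall x, continuous g x) -> (forall x, continuous h x) ->
  RInt g a b - RInt h a b = RInt (fun t => g t - h t) a b.
Proof.
  intros Cg Ch. symmetry.
  apply (RInt_minus (V := R_CompleteNormedModule)); now apply continuous_ex_RInt.
Qed.

Section Picard.

Variables (f : R -> R -> R) (L M phi : R).
Hypothesis f_continuous : forall y : R -> R,
  (forall x, continuous y x) -> forall x, continuous (fun t => f t (y t)) x.
Hypothesis f_lipschitz : forall t y z, Rabs (f t y - f t z) <= L * Rabs (y - z).
Hypothesis f_bounded : forall t y, Rabs (f t y) <= M.

(** Integrating only up to the clamped abscissa keeps every iterate continuous
    and bounded on the line while the contraction is estimated on the
    interval. *)
Definition picard_step (y : R -> R) (x : R) : R :=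
  phi + RInt (fun t => f t (y t)) (-1) (clamp x).

Definition picard (n : nat) : R -> R := Nat.iter n picard_step (fun _ => phi).

Lemma picard_step_lipschitz y :
  (forall x, continuous y x) -> forall a b,
  Rabs (picard_step y a - picard_step y b) <= M * Rabs (a - b).
Proof.
  intros C a b. unfold picard_step.
  pose proof (f_continuous y C) as Cf.
  rewrite Rminus_plus_l_l, RInt_sub_Chasles by assumption.
  eapply Rle_trans; [apply (abs_RInt_le_bound _ _ _ M); auto|].
  apply Rmult_le_compat_l; [|apply clamp_lipschitz].
  eapply Rle_trans; [|apply (f_bounded 0 0)]. apply Rabs_pos.
Qed.

Lemma picard_continuous n x : continuous (picard n) x.
Proof.
  revert x. induction n as [|n IH]; intros x.
  - apply continuous_const.
  - apply lipschitz_continuous with M. now apply picard_step_lipschitz.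
Qed.

Lemma L_nonneg : 0 <= L.
Proof.
  pose proof (f_lipschitz 0 1 0) as H. pose proof (Rabs_pos (f 0 1 - f 0 0)).
  rewrite Rminus_0_r, Rabs_R1 in H. lra.
Qed.

(** In the weighted norm sup |y t| exp (- 2 L (t + 1)) the step contracts by 1/2
    whatever L is, so the iteration converges on the whole interval and no
    gluing of local solutions is necessary. *)
Lemma picard_step_contraction y z A :
  (forall x, continuous y x) -> (forall x, continuous z x) ->
  (forall t, Icc t -> Rabs (y t - z t) <= A * exp (2 * L * (t + 1))) ->
  forall x, Rabs (picard_step y x - picard_step z x)
            <= A / 2 * exp (2 * L * (clamp x + 1)).
Proof.
  intros Cy Cz B x.
  pose proof (f_continuous y Cy) as Cfy. pose proof (f_continuous z Cz) as Cfz.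
  pose proof (clamp_Icc x) as Hx. set (c := clamp x) in *.
  assert (HA : 0 <= A).
  { specialize (B (-1) ltac:(unfold Icc; lra)).
    replace (2 * L * (-1 + 1)) with 0 in B by ring. rewrite exp_0 in B.
    pose proof (Rabs_pos (y (-1) - z (-1))). lra. }
  unfold picard_step. fold c.
  rewrite Rminus_plus_l_l, RInt_sub by assumption.
  set (G := fun t => A / 2 * exp (2 * L * (t + 1))).
  apply Rle_trans with (minus (G c) (G (-1))).
  - apply (norm_RInt_le (V := R_NormedModule) (fun t => f t (y t) - f t (z t))
             (fun t => A * L * exp (2 * L * (t + 1))) (-1) c).
    + apply Hx.
    + intros t Ht.
      apply Rle_trans with (1 := f_lipschitz _ _ _).
      replace (A * L * exp (2 * L * (t + 1))) with (L * (A * exp (2 * L * (t + 1)))) by ring.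
      apply Rmult_le_compat_l; [apply L_nonneg|]. apply B. unfold Icc in *; lra.
    + apply (RInt_correct (V := R_CompleteNormedModule)), continuous_ex_RInt.
      intros t. now apply (continuous_minus (V := R_NormedModule)).
    + apply (is_RInt_derive (V := R_CompleteNormedModule) G).
      * intros t _. unfold G. auto_derive; [trivial|]. field.
      * intros t _. apply (ex_derive_continuous (V := R_NormedModule)).
        auto_derive; trivial.
  - unfold G, minus, plus, opp; simpl.
    pose proof (exp_pos (2 * L * (-1 + 1))).
    assert (0 <= A / 2) by lra. nra.
Qed.

Let B := 2 * M * exp (4 * L).

Lemma picard_increment n x : Rabs (picard (S n) x - picard n x) <= B * (/ 2) ^ n.
Proof.
  assert (HM : 0 <= M).
  { eapply Rle_trans; [|apply (f_bounded 0 0)]. apply Rabs_pos. }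
  assert (HL := L_nonneg).
  (* the weighted bound decays like 2^-n; the weight is at most exp (4 L) *)
  assert (W : forall n x, Rabs (picard (S n) x - picard n x) <=
              2 * M * (/ 2) ^ n * exp (2 * L * (clamp x + 1))).
  { clear n x. induction n as [|n IH]; intros x.
    - change (Rabs (picard_step (fun _ => phi) x - phi) <= 2 * M * 1 * exp (2 * L * (clamp x + 1))).
      unfold picard_step.
      rewrite Rplus_minus_l.
      pose proof (clamp_Icc x) as Hx. unfold Icc in Hx.
      pose proof (one_le_exp (2 * L * (clamp x + 1)) ltac:(nra)).
      eapply Rle_trans; [apply (abs_RInt_le_bound _ _ _ M)|].
      + apply (f_continuous (fun _ => phi)). intros t; apply continuous_const.
      + intros t; apply f_bounded.
      + rewrite Rabs_pos_eq by lra. nra.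
    - replace (2 * M * (/ 2) ^ S n) with ((2 * M * (/ 2) ^ n) / 2) by (simpl; field).
      apply (picard_step_contraction (picard (S n)) (picard n)); try apply picard_continuous.
      intros t Ht. specialize (IH t). now rewrite clamp_id in IH. }
  eapply Rle_trans; [apply W|]. unfold B.
  replace (2 * M * exp (4 * L) * (/ 2) ^ n) with (2 * M * (/ 2) ^ n * exp (4 * L)) by ring.
  apply Rmult_le_compat_l.
  - apply Rmult_le_pos; [lra|]. apply pow_le; lra.
  - apply exp_le_mono. pose proof (clamp_Icc x) as Hx. unfold Icc in Hx. nra.
Qed.

Lemma B_nonneg : 0 <= B.
Proof.
  pose proof (picard_increment 0 0) as H. simpl in H. rewrite Rmult_1_r in H.
  eapply Rle_trans; [apply Rabs_pos|apply H].
Qed.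

Lemma picard_cauchy n k x : Rabs (picard (n + k) x - picard n x) <= 2 * B * (/ 2) ^ n.
Proof.
  pose proof B_nonneg as HB.
  assert (H : Rabs (picard (n + k) x - picard n x) <= 2 * B * ((/ 2) ^ n - (/ 2) ^ (n + k))).
  { induction k as [|k IH].
    - rewrite Nat.add_0_r, !Rminus_diag, Rabs_R0. lra.
    - rewrite Nat.add_succ_r.
      replace (picard (S (n + k)) x - picard n x) with
        ((picard (S (n + k)) x - picard (n + k) x) + (picard (n + k) x - picard n x)) by ring.
      eapply Rle_trans; [apply Rabs_triang|].
      pose proof (picard_increment (n + k) x). simpl pow. lra. }
  assert (0 < (/ 2) ^ (n + k)) by (apply pow_lt; lra). nra.
Qed.

Lemma pow_half_lim C : is_lim_seq (fun n => C * (/ 2) ^ n) 0.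
Proof.
  replace (Finite 0) with (Rbar_mult C 0) by (simpl; f_equal; ring).
  apply is_lim_seq_scal_l, is_lim_seq_geom. rewrite Rabs_pos_eq; lra.
Qed.

Lemma picard_limit : exists Y : R -> R, forall n x, Rabs (picard n x - Y x) <= 2 * B * (/ 2) ^ n.
Proof.
  pose proof B_nonneg as HB.
  assert (E : forall x, ex_finite_lim_seq (fun n => picard n x)).
  { intros x. apply ex_lim_seq_cauchy_corr. intros eps.
    assert (H := pow_half_lim (2 * (2 * B))). apply is_lim_seq_spec in H.
    destruct (H eps) as [N HN]. exists N. intros n m Hn Hm.
    replace n with (N + (n - N))%nat by lia. replace m with (N + (m - N))%nat by lia.
    assert (H1 := picard_cauchy N (n - N) x). assert (H2 := picard_cauchy N (m - N) x).
    specialize (HN N (Nat.le_refl N)). rewrite Rminus_0_r in HN.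
    apply Rabs_def2 in HN.
    rewrite Rabs_minus_sym in H2.
    replace (picard (N + (n - N)) x - picard (N + (m - N)) x) with
      ((picard (N + (n - N)) x - picard N x) + (picard N x - picard (N + (m - N)) x)) by ring.
    eapply Rle_lt_trans; [apply Rabs_triang|]. lra. }
  exists (fun x => real (Lim_seq (fun n => picard n x))). intros n x.
  pose proof (Lim_seq_correct' _ (E x)) as Hl.
  apply (is_lim_seq_incr_n _ n) in Hl.
  rewrite Rabs_minus_sym.
  apply (is_lim_seq_le (fun k => Rabs (picard (k + n) x - picard n x))
           (fun _ => 2 * B * (/ 2) ^ n) (Rabs (Lim_seq (fun n => picard n x) - picard n x))
           (2 * B * (/ 2) ^ n)).
  - intros k. rewrite Nat.add_comm. apply picard_cauchy.
  - apply is_lim_seq_abs with (l := Finite _). apply is_lim_seq_minus' ; [exact Hl|apply is_lim_seq_const].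
  - apply is_lim_seq_const.
Qed.

Lemma eq_of_half_bounds a b C : (forall n, Rabs (a - b) <= C * (/ 2) ^ n) -> a = b.
Proof.
  intros H. assert (Rabs (a - b) <= 0).
  { apply (is_lim_seq_le (fun _ => Rabs (a - b)) _ (Rabs (a - b)) 0 H).
    - apply is_lim_seq_const.
    - apply pow_half_lim. }
  pose proof (Rabs_pos (a - b)). assert (a - b = 0); [|lra].
  destruct (Req_dec (a - b) 0) as [|n]; [assumption|]. pose proof (Rabs_pos_lt _ n). lra.
Qed.

(** The iterates converge geometrically and are uniformly M-Lipschitz, so their
    limit is continuous and the integral equation passes to the limit. *)
Lemma picard_lindelof : exists y : R -> R,
  y (-1) = phi /\ (forall x, continuous y x) /\
  forall x, Icc x -> is_derive y x (f x (y x)).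
Proof.
  destruct picard_limit as [Y HY]. pose proof B_nonneg as HB. pose proof L_nonneg as HL.
  assert (HM : 0 <= M).
  { eapply Rle_trans; [|apply (f_bounded 0 0)]. apply Rabs_pos. }
  assert (CY : forall x, continuous Y x).
  { apply lipschitz_continuous with M. intros a b.
    apply le_epsilon. intros e He.
    assert (H := pow_half_lim (2 * (2 * B))). apply is_lim_seq_spec in H.
    destruct (H (mkposreal e He)) as [N HN].
    specialize (HN (S N) ltac:(lia)). rewrite Rminus_0_r in HN. simpl in HN.
    apply Rabs_def2 in HN.
    pose proof (HY (S N) a) as Ha. pose proof (HY (S N) b) as Hb. simpl pow in Ha, Hb.
    rewrite Rabs_minus_sym in Ha.
    pose proof (picard_step_lipschitz (picard N) (picard_continuous N) a b) as Hl.
    change (picard_step (picard N)) with (picard (S N)) in Hl.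
    replace (Y a - Y b) with ((Y a - picard (S N) a) + ((picard (S N) a - picard (S N) b) +
       (picard (S N) b - Y b))) by ring.
    eapply Rle_trans; [apply Rabs_triang|].
    pose proof (Rabs_triang (picard (S N) a - picard (S N) b) (picard (S N) b - Y b)). lra. }
  assert (FY : forall x, Y x = picard_step Y x).
  { intros x. apply eq_of_half_bounds with (2 * B + 2 * (L * (2 * B))). intros n.
    pose proof (HY (S n) x) as H1. rewrite Rabs_minus_sym in H1.
    assert (H2 : Rabs (picard (S n) x - picard_step Y x) <= 2 * (L * (2 * B * (/ 2) ^ n))).
    { change (picard (S n) x) with (picard_step (picard n) x). unfold picard_step.
      pose proof (f_continuous _ (picard_continuous n)) as C1. pose proof (f_continuous _ CY) as C2.
      rewrite Rminus_plus_l_l, RInt_sub by assumption.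
      pose proof (clamp_Icc x) as Hx. unfold Icc in Hx.
      assert (0 <= L * (2 * B * (/ 2) ^ n)).
      { apply Rmult_le_pos; [lra|]. apply Rmult_le_pos; [lra|]. apply pow_le; lra. }
      eapply Rle_trans; [apply (abs_RInt_le_bound _ _ _ (L * (2 * B * (/ 2) ^ n)))|].
      - intros t. now apply (continuous_minus (V := R_NormedModule)).
      - intros t. eapply Rle_trans; [apply f_lipschitz|].
        apply Rmult_le_compat_l; [lra|]. apply HY.
      - rewrite Rabs_pos_eq by lra. nra. }
    replace (Y x - picard_step Y x) with
      ((Y x - picard (S n) x) + (picard (S n) x - picard_step Y x)) by ring.
    eapply Rle_trans; [apply Rabs_triang|]. simpl pow in H1.
    assert (0 <= (/ 2) ^ n) by (apply pow_le; lra). nra. }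
  set (y := fun x => phi + RInt (fun t => f t (Y t)) (-1) x).
  assert (Dy : forall x, is_derive y x (f x (Y x))).
  { intros x. apply (is_derive_primitive (fun t => f t (Y t))). auto. }
  exists y. split; [apply primitive_at|]. split.
  - intros x. eapply is_derive_continuous, Dy.
  - intros x Hx. replace (y x) with (Y x); [apply Dy|].
    rewrite FY. unfold picard_step. now rewrite clamp_id.
Qed.

End Picard.

(** * Estimates for the elementary functions *)

Lemma sin_lipschitz a b : Rabs (sin a - sin b) <= Rabs (a - b).
Proof.
  rewrite <- (Rmult_1_l (Rabs (a - b))).
  apply lipschitz_of_derivative with cos.
  - intros x _. auto_derive; [trivial|ring].
  - intros x _. apply Rabs_le, COS_bound.
Qed.

Lemma sincos_lipschitz a b : Rabs (sin a * cos a - sin b * cos b) <= Rabs (a - b).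
Proof.
  rewrite <- (Rmult_1_l (Rabs (a - b))).
  apply lipschitz_of_derivative with (f := fun x => sin x * cos x) (f' := fun x => cos (2 * x)).
  - intros x _. auto_derive; [trivial|]. rewrite cos_2a. ring.
  - intros x _. apply Rabs_le, COS_bound.
Qed.

Lemma cos2_lipschitz a b : Rabs (cos a ^ 2 - cos b ^ 2) <= Rabs (a - b).
Proof.
  rewrite <- (Rmult_1_l (Rabs (a - b))).
  apply lipschitz_of_derivative with (f := fun x => cos x ^ 2) (f' := fun x => - sin (2 * x)).
  - intros x _. auto_derive; [trivial|]. rewrite sin_2a. ring.
  - intros x _. rewrite Rabs_Ropp. apply Rabs_le, SIN_bound.
Qed.

Lemma exp_lipschitz a b K : a <= K -> b <= K -> Rabs (exp a - exp b) <= exp K * Rabs (a - b).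
Proof.
  intros Ha Hb. apply lipschitz_of_derivative with exp.
  - intros x _. auto_derive; [trivial|ring].
  - intros x Hx. rewrite Rabs_pos_eq by (left; apply exp_pos). apply exp_le_mono.
    revert Hx. unfold Rmax; destruct Rle_dec; lra.
Qed.

Lemma sin_shift k x : sin (x + INR k * PI) = (-1) ^ k * sin x.
Proof.
  induction k as [|k IH].
  - simpl. rewrite Rmult_0_l, Rplus_0_r. ring.
  - rewrite S_INR. replace (x + (INR k + 1) * PI) with ((x + INR k * PI) + PI) by ring.
    rewrite neg_sin, IH. simpl. ring.
Qed.

Lemma small_sin_angle a : Rabs a < PI / 2 -> Rabs (sin a) <= 1 / 2 -> - (PI / 6) <= a <= PI / 6.
Proof.
  intros Ha Hs. apply Rabs_def2 in Ha. pose proof PI_RGT_0.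
  apply Rabs_le_between in Hs. rewrite <- sin_PI6, <- sin_neg in Hs.
  split; [apply sin_incr_0 | apply sin_incr_0]; lra.
Qed.

(** Where |sin| <= 1/2 inside such an interval the cosine is at least 1/2 in
    absolute value, which makes the sine invertible with constant 2. *)
Lemma sin_inverse_lipschitz k a b :
  Rabs (a - INR k * PI) < PI / 2 -> Rabs (b - INR k * PI) < PI / 2 ->
  Rabs (sin a) <= 1 / 2 -> Rabs (sin b) <= 1 / 2 ->
  Rabs (a - b) <= 2 * Rabs (sin a - sin b).
Proof.
  set (a' := a - INR k * PI). set (b' := b - INR k * PI).
  replace a with (a' + INR k * PI) by (unfold a'; ring).
  replace b with (b' + INR k * PI) by (unfold b'; ring).
  intros Ha Hb. rewrite !sin_shift, <- Rmult_minus_distr_l, !Rabs_mult, !pow_1_abs, !Rmult_1_l.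
  intros Sa Sb.
  replace (a' + INR k * PI - (b' + INR k * PI)) with (a' - b') by ring.
  pose proof (small_sin_angle a' Ha Sa) as Ia. pose proof (small_sin_angle b' Hb Sb) as Ib.
  destruct (MVT_gen sin b' a' cos) as [c [Hc ->]].
  - intros x _. auto_derive; [trivial|ring].
  - intros x _. apply continuity_sin.
  - assert (Hc' : - (PI / 3) <= c <= PI / 3).
    { revert Hc; unfold Rmin, Rmax; destruct Rle_dec; pose proof PI_RGT_0; lra. }
    assert (Hcos : 1 / 2 <= cos c).
    { rewrite <- cos_PI3. pose proof PI_RGT_0. destruct (Rle_dec 0 c).
      - apply cos_decr_1; lra.
      - rewrite <- (cos_neg c). apply cos_decr_1; lra. }
    rewrite Rabs_mult, (Rabs_pos_eq (cos c)) by lra.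
    pose proof (Rabs_pos (a' - b')). nra.
Qed.

Lemma cos_lower_bound a : Rabs (sin a) <= 1 / 2 -> 1 / 2 <= Rabs (cos a).
Proof.
  intros H. pose proof (sin2_cos2 a) as E. unfold Rsqr in E.
  apply Rabs_le_between in H.
  assert (3 / 4 <= Rabs (cos a) * Rabs (cos a)).
  { rewrite <- Rabs_mult, Rabs_pos_eq by nra. nra. }
  pose proof (Rabs_pos (cos a)). nra.
Qed.

Lemma small_sin_index t : 0 <= t -> Rabs (sin t) <= 1 / 2 ->
  exists k, Rabs (t - INR k * PI) < PI / 2.
Proof.
  intros Ht Hs. pose proof PI_RGT_0 as Hpi.
  set (y := t / PI). assert (Ey : t = y * PI) by (unfold y; field; lra).
  assert (Hy : 0 <= y) by (apply Rmult_le_pos; [assumption|left; now apply Rinv_0_lt_compat]).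
  destruct (nfloor_ex (y + 1 / 2)) as [k [Hk1 Hk2]]; [lra|].
  assert (H1 : INR k * PI - PI / 2 <= t) by (rewrite Ey; nra).
  assert (H2 : t < INR k * PI + PI / 2) by (rewrite Ey; nra).
  exists k. apply Rabs_def1; [lra|].
  destruct (Req_dec t (INR k * PI - PI / 2)) as [E|]; [|lra].
  replace t with (- (PI / 2) + INR k * PI) in Hs by lra.
  rewrite sin_shift, Rabs_mult, pow_1_abs, sin_neg, sin_PI2, Rabs_Ropp, Rabs_R1 in Hs. lra.
Qed.

(** Every line through the origin has a direction in the half-open half circle;
    A and B are the Cauchy data of a solution in Pruefer scaling. *)
Lemma direction_angle A B : exists phi, - (PI / 2) < phi <= PI / 2 /\ A * cos phi - B * sin phi = 0.
Proof.
  pose proof PI_RGT_0 as Hpi.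
  destruct (Req_dec B 0) as [->|HB].
  - exists (PI / 2). rewrite cos_PI2, sin_PI2. lra.
  - exists (atan (A / B)). pose proof (atan_bound (A / B)). split; [lra|].
    assert (Hc : cos (atan (A / B)) <> 0) by (apply Rgt_not_eq, cos_gt_0; lra).
    pose proof (tan_atan (A / B)) as E. unfold tan in E.
    replace (sin (atan (A / B))) with (A / B * cos (atan (A / B))).
    + field. assumption.
    + rewrite <- E at 1. field. assumption.
Qed.

(** * Pruefer variables *)

Section Weight.

Variables (p q : R -> R) (p0 p1 Q : R).
Hypothesis p0_pos : 0 < p0.
Hypothesis p_bounds : forall x, Icc x -> p0 <= p x <= p1.
Hypothesis p_derive : forall x, is_derive p x (q x * p x).
Hypothesis q_continuous : forall x, continuous q x.
Hypothesis q_bound : forall x, Icc x -> Rabs (q x) <= Q.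

Lemma Q_nonneg : 0 <= Q.
Proof.
  eapply Rle_trans; [apply Rabs_pos|apply (q_bound 0)]. unfold Icc; lra.
Qed.

Lemma p1_pos : 0 < p1.
Proof. pose proof (p_bounds 0 ltac:(unfold Icc; lra)). lra. Qed.

(** The angle and the logarithm of the amplitude of a solution of
    u'' = - s^2 p^2 u.  The parameter s may be any real number; s = 0 gives the
    trivial reference solution from which the eigenvalues are counted. *)
Definition pruefer (s : R) (th rho : R -> R) : Prop :=
  (forall x, Icc x -> is_derive th x (s * p x + q x * (sin (th x) * cos (th x)))) /\
  (forall x, Icc x -> is_derive rho x (- (q x * cos (th x) ^ 2))).

(** The right-hand side of the angle equation is bounded and, since the
    derivative of sin cos is at most 1, Q-Lipschitz in the angle. *)
Lemma pruefer_exists s phi :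
  exists thrho : (R -> R) * (R -> R),
    pruefer s (fst thrho) (snd thrho) /\ fst thrho (-1) = phi.
Proof.
  assert (Cp : forall x, continuous p x).
  { intros x. eapply is_derive_continuous, p_derive. }
  set (f := fun t y => s * p (clamp t) + q (clamp t) * (sin y * cos y)).
  assert (Csc : forall x, continuous (fun y => sin y * cos y) x).
  { intros x. apply lipschitz_continuous with 1. intros a b.
    rewrite Rmult_1_l. apply sincos_lipschitz. }
  destruct (picard_lindelof f Q (Rabs s * p1 + Q) phi) as (th & H1 & H2 & H3).
  - intros y Cy x. unfold f.
    apply (continuous_plus (V := R_NormedModule)).
    + apply (continuous_mult (K := R_AbsRing)); [apply continuous_const|].
      apply (continuous_comp clamp p); [apply clamp_continuous|apply Cp].
    + apply (continuous_mult (K := R_AbsRing)).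
      * apply (continuous_comp clamp q); [apply clamp_continuous|apply q_continuous].
      * apply (continuous_comp y (fun y => sin y * cos y)); [apply Cy|apply Csc].
  - intros t y z. unfold f.
    replace (s * p (clamp t) + q (clamp t) * (sin y * cos y) -
       (s * p (clamp t) + q (clamp t) * (sin z * cos z))) with
       (q (clamp t) * (sin y * cos y - sin z * cos z)) by ring.
    rewrite Rabs_mult. apply Rmult_le_compat; try apply Rabs_pos.
    + apply q_bound, clamp_Icc.
    + apply sincos_lipschitz.
  - intros t y. unfold f. eapply Rle_trans; [apply Rabs_triang|].
    rewrite !Rabs_mult. pose proof (p_bounds _ (clamp_Icc t)).
    pose proof (q_bound _ (clamp_Icc t)). rewrite (Rabs_pos_eq (p (clamp t))) by lra.
    assert (Rabs (sin y) <= 1) by apply Rabs_le, SIN_bound.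
    assert (Rabs (cos y) <= 1) by apply Rabs_le, COS_bound.
    pose proof (Rabs_pos s). pose proof (Rabs_pos (q (clamp t))).
    pose proof (Rabs_pos (sin y)). pose proof (Rabs_pos (cos y)).
    apply Rplus_le_compat; [nra|].
    rewrite <- (Rmult_1_r Q). apply Rmult_le_compat; try nra.
  - exists (th, fun x => 0 + RInt (fun t => - (q t * cos (th t) ^ 2)) (-1) x).
    split; [split|assumption]; simpl fst; simpl snd.
    + intros x Hx. specialize (H3 x Hx). unfold f in H3. now rewrite clamp_id in H3.
    + intros x _. apply (is_derive_primitive (fun t => - (q t * cos (th t) ^ 2))).
      intros t. apply (continuous_opp (V := R_NormedModule)).
      apply (continuous_mult (K := R_AbsRing)); [apply q_continuous|].
      apply (continuous_comp th (fun y => cos y ^ 2)); [apply H2|].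
      apply lipschitz_continuous with 1. intros a b. rewrite Rmult_1_l. apply cos2_lipschitz.
Qed.

Definition pruefer_solution (s phi : R) : (R -> R) * (R -> R) :=
  proj1_sig (constructive_indefinite_description _ (pruefer_exists s phi)).
Definition angle s phi := fst (pruefer_solution s phi).
Definition logamp s phi := snd (pruefer_solution s phi).

Lemma pruefer_angle s phi : pruefer s (angle s phi) (logamp s phi).
Proof.
  unfold angle, logamp, pruefer_solution.
  destruct constructive_indefinite_description as [y [H1 H2]]. exact H1.
Qed.

Lemma angle_initial s phi : angle s phi (-1) = phi.
Proof.
  unfold angle, pruefer_solution.
  destruct constructive_indefinite_description as [y [H1 H2]]. exact H2.
Qed.

(** The common feature of a difference of two angles (sigma is the difference of
    the parameters) and of the linearised angle of a resonant solution. *)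
Definition forced (sigma : R) (w : R -> R) : Prop :=
  exists w', (forall x, Icc x -> is_derive w x (w' x)) /\
             (forall x, Icc x -> Rabs (w' x - sigma * p x) <= Q * Rabs (w x)).

(** The Gronwall factor in [forced_bound]. *)
Definition growth := exp (2 * (Q + 1)).
(** The slope of the linear barrier in [forced_gain]; it solves
    gain + 3 Q gain = p0 / 2. *)
Definition gain := p0 / (2 * (1 + 3 * Q)).
(** How much the solution, divided by its amplitude at an endpoint, may change
    per unit of |w(-1)| + sigma p1. *)
Definition cost := exp (2 * Q) * (1 + 2 * Q) * growth.
(** Chosen so that threshold * cost * (gain + p1) = gain / 8: the boundary terms
    then consume only a fraction of the gain. *)
Definition threshold := gain / (8 * cost * (gain + p1)).

Lemma growth_ge1 : 1 <= growth.
Proof. apply one_le_exp. pose proof Q_nonneg; lra. Qed.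

Lemma gain_pos : 0 < gain.
Proof. pose proof Q_nonneg. apply Rdiv_lt_0_compat; lra. Qed.

Lemma cost_ge : exp (2 * Q) <= cost.
Proof.
  unfold cost. pose proof Q_nonneg. pose proof growth_ge1. pose proof (exp_pos (2 * Q)).
  rewrite Rmult_assoc. assert (1 <= (1 + 2 * Q) * growth) by nra. nra.
Qed.

Lemma cost_ge1 : 1 <= cost.
Proof.
  pose proof cost_ge. pose proof Q_nonneg. pose proof (one_le_exp (2 * Q)). lra.
Qed.

Lemma threshold_pos : 0 < threshold.
Proof.
  pose proof gain_pos. pose proof cost_ge1. pose proof p1_pos.
  apply Rdiv_lt_0_compat; [assumption|]. apply Rmult_lt_0_compat; lra.
Qed.

Lemma threshold_cost : threshold * cost * (gain + p1) = gain / 8.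
Proof.
  pose proof gain_pos. pose proof cost_ge1. pose proof p1_pos.
  unfold threshold. field. split; lra.
Qed.

Lemma threshold_cost_le : threshold * cost <= 1 / 8.
Proof.
  pose proof threshold_cost. pose proof gain_pos. pose proof p1_pos.
  assert (0 < threshold * cost) by (apply Rmult_lt_0_compat; [apply threshold_pos|pose proof cost_ge1; lra]).
  nra.
Qed.

Lemma forced_bound sigma w x :
  0 <= sigma -> forced sigma w -> Icc x ->
  Rabs (w x) <= growth * (Rabs (w (-1)) + sigma * p1).
Proof.
  intros Hs (w' & D & B) Hx.
  assert (0 <= sigma * p1) by (pose proof p1_pos; nra).
  apply gronwall with w'; auto using Q_nonneg.
  intros t Ht. specialize (B t Ht). pose proof (p_bounds t Ht).
  assert (Rabs (sigma * p t) <= sigma * p1).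
  { rewrite Rabs_pos_eq by nra. nra. }
  replace (w' t) with (sigma * p t + (w' t - sigma * p t)) by ring.
  eapply Rle_trans; [apply Rabs_triang|]. lra.
Qed.

(** The line of slope gain * sigma through the origin is a subsolution: along it
    |w| <= gain * sigma, hence w' >= sigma p0 - Q gain sigma, which exceeds the
    slope; at -1 it starts at - gain * sigma. *)
Lemma forced_gain sigma w :
  0 < sigma -> forced sigma w -> Rabs (w (-1)) <= gain * sigma -> gain * sigma < w 1.
Proof.
  intros Hs (w' & D & B) Hw. pose proof gain_pos as Hg. pose proof Q_nonneg as HQ.
  apply Rabs_le_between in Hw.
  assert (0 < w 1 - gain * sigma * 1); [|lra].
  apply (positive_of_crossing_upward (fun x => w x - gain * sigma * x)
          (fun x => w' x - gain * sigma) (-1) 1); [| |intros x Hx H0|lra].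
  - intros x Hx. evar_last.
    + apply (is_derive_minus (V := R_NormedModule)); [now apply D|].
      apply (is_derive_scal (fun x => x)), (is_derive_id (K := R_AbsRing)).
    + unfold minus, plus, opp, one; simpl. ring.
  - lra.
  - specialize (B x Hx). pose proof (p_bounds x Hx).
    assert (Hw' : w x = gain * sigma * x) by lra.
    assert (Rabs (w x) <= gain * sigma).
    { rewrite Hw'. apply Rabs_le. nra. }
    apply Rabs_le_between in B.
    assert (E : gain + 3 * Q * gain = p0 / 2) by (unfold gain; field; lra).
    assert (Q * Rabs (w x) <= Q * (gain * sigma)) by now apply Rmult_le_compat_l.
    assert (sigma * p0 <= sigma * p x) by (apply Rmult_le_compat_l; lra).
    assert (0 <= Q * (gain * sigma)) by (apply Rmult_le_pos; nra).
    assert (E' : gain * sigma + 3 * (Q * (gain * sigma)) = p0 / 2 * sigma) by (rewrite <- E; ring).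
    nra.
Qed.

Lemma forced_initial_small gamma sigma w :
  0 <= sigma -> 0 <= gamma <= threshold ->
  Rabs (w (-1)) <= 2 * (gamma * (cost * (Rabs (w (-1)) + sigma * p1))) ->
  Rabs (w (-1)) <= gain * sigma.
Proof.
  intros Hs Hg H.
  pose proof threshold_cost as E. pose proof threshold_cost_le. pose proof gain_pos.
  pose proof p1_pos. pose proof cost_ge1. pose proof (Rabs_pos (w (-1))).
  assert (gamma * cost <= threshold * cost) by (apply Rmult_le_compat_r; lra).
  assert (0 <= gamma * cost) by (apply Rmult_le_pos; lra).
  set (t := threshold * cost) in *. set (g := gamma * cost) in *.
  assert (Hp : t * p1 <= gain / 8) by nra.
  replace (gamma * (cost * (Rabs (w (-1)) + sigma * p1))) with
     (g * Rabs (w (-1)) + g * p1 * sigma) in H by (unfold g; ring).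
  assert (g * p1 * sigma <= gain / 8 * sigma).
  { apply Rmult_le_compat_r; [lra|]. apply Rle_trans with (2 := Hp). nra. }
  nra.
Qed.

(** If sigma were positive, the bound at -1 would make w(-1) small compared with
    sigma, then w(1) would exceed gain * sigma, contradicting the bound at 1. *)
Lemma forced_rigidity gamma sigma w :
  0 <= sigma -> 0 <= gamma <= threshold -> forced sigma w ->
  (forall s, Rabs (w (pmR s)) <= 2 * (gamma * (cost * (Rabs (w (-1)) + sigma * p1)))) ->
  sigma = 0.
Proof.
  intros Hs Hg F H.
  destruct (Req_dec sigma 0) as [|Hn]; [assumption|exfalso].
  assert (Hi : Rabs (w (-1)) <= gain * sigma).
  { apply forced_initial_small with gamma; auto. apply (H Minus). }
  pose proof (forced_gain sigma w ltac:(lra) F Hi) as Hw.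
  pose proof (H Plus) as H1. simpl in H1. pose proof (Rle_abs (w 1)).
  pose proof threshold_cost as E. pose proof gain_pos. pose proof p1_pos. pose proof cost_ge1.
  assert (gamma * cost <= threshold * cost) by (apply Rmult_le_compat_r; lra).
  assert (0 <= gamma * cost) by (apply Rmult_le_pos; lra).
  assert (Hb : gamma * (cost * (Rabs (w (-1)) + sigma * p1)) <= gain / 8 * sigma).
  { rewrite <- E, <- Rmult_assoc.
    apply Rle_trans with (gamma * cost * ((gain + p1) * sigma)).
    - apply Rmult_le_compat_l; [assumption|]. lra.
    - rewrite (Rmult_assoc (threshold * cost)). apply Rmult_le_compat_r; nra. }
  nra.
Qed.

(** The forcing is (s2 - s1) p, and the remaining terms differ by at most Q |w|
    because sin cos is 1-Lipschitz. *)
Lemma angle_difference_forced s1 s2 th1 th2 rho1 rho2 :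
  pruefer s1 th1 rho1 -> pruefer s2 th2 rho2 ->
  forced (s2 - s1) (fun x => th2 x - th1 x).
Proof.
  intros [D1 _] [D2 _].
  exists (fun x => (s2 * p x + q x * (sin (th2 x) * cos (th2 x))) -
                   (s1 * p x + q x * (sin (th1 x) * cos (th1 x)))). split.
  - intros x Hx. apply (is_derive_minus (V := R_NormedModule)); auto.
  - intros x Hx.
    match goal with |- Rabs ?e <= _ => replace e with
      (q x * (sin (th2 x) * cos (th2 x) - sin (th1 x) * cos (th1 x))) by ring end.
    rewrite Rabs_mult. apply Rmult_le_compat; try apply Rabs_pos; auto using sincos_lipschitz.
Qed.

(** The derivative of rho is bounded by Q, independently of s. *)
Lemma logamp_oscillation s th rho x e :
  pruefer s th rho -> Icc x -> Icc e -> Rabs (rho x - rho e) <= 2 * Q.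
Proof.
  intros [_ D] Hx He.
  apply Rle_trans with (Q * Rabs (x - e)).
  - apply (lipschitz_Icc rho (fun t => - (q t * cos (th t) ^ 2))); auto.
    intros t Ht. pose proof (COS_bound (th t)). pose proof (q_bound t Ht).
    rewrite Rabs_Ropp, Rabs_mult, (Rabs_pos_eq (cos _ ^ 2)) by nra.
    pose proof (Rabs_pos (q t)).
    assert (cos (th t) ^ 2 <= 1) by nra. assert (0 <= cos (th t) ^ 2) by nra. nra.
  - pose proof Q_nonneg. assert (Rabs (x - e) <= 2); [|nra].
    apply Rabs_le. unfold Icc in *; lra.
Qed.

(** The solution divided by its amplitude at the point e, so that its value at e
    is the sine of the angle. *)
Definition normalised (th rho : R -> R) (e x : R) : R := exp (rho x - rho e) * sin (th x).

Lemma normalised_bound s th rho x e :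
  pruefer s th rho -> Icc x -> Icc e -> Rabs (normalised th rho e x) <= exp (2 * Q).
Proof.
  intros P Hx He. unfold normalised. rewrite Rabs_mult.
  pose proof (logamp_oscillation s th rho x e P Hx He) as H. apply Rabs_le_between in H.
  rewrite Rabs_pos_eq by (left; apply exp_pos).
  assert (Rabs (sin (th x)) <= 1) by apply Rabs_le, SIN_bound.
  pose proof (exp_le_mono (rho x - rho e) (2 * Q) ltac:(lra)).
  pose proof (exp_pos (rho x - rho e)). pose proof (Rabs_pos (sin (th x))). nra.
Qed.

(** Both the sine of the angle and rho x - rho e are Lipschitz in the angle, with
    constants that do not depend on the parameters. *)
Lemma normalised_difference s1 s2 th1 th2 rho1 rho2 x e :
  s1 <= s2 -> pruefer s1 th1 rho1 -> pruefer s2 th2 rho2 -> Icc x -> Icc e ->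
  Rabs (normalised th2 rho2 e x - normalised th1 rho1 e x)
    <= cost * (Rabs (th2 (-1) - th1 (-1)) + (s2 - s1) * p1).
Proof.
  intros Hs P1 P2 Hx He.
  pose proof (angle_difference_forced _ _ _ _ _ _ P1 P2) as F.
  set (W := growth * (Rabs (th2 (-1) - th1 (-1)) + (s2 - s1) * p1)).
  assert (HW : forall t, Icc t -> Rabs (th2 t - th1 t) <= W).
  { intros t Ht. apply (forced_bound (s2 - s1) (fun x => th2 x - th1 x)); auto; lra. }
  assert (HW0 : 0 <= W) by (eapply Rle_trans; [apply Rabs_pos|apply (HW x Hx)]).
  assert (HQ := Q_nonneg).
  assert (Hr : Rabs ((rho2 x - rho1 x) - (rho2 e - rho1 e)) <= 2 * Q * W).
  { apply Rle_trans with (Q * W * Rabs (x - e)).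
    - apply (lipschitz_Icc (fun x => rho2 x - rho1 x)
        (fun x => - (q x * cos (th2 x) ^ 2) - - (q x * cos (th1 x) ^ 2))); auto.
      + intros t Ht. apply (is_derive_minus (V := R_NormedModule)); [apply P2, Ht|apply P1, Ht].
      + intros t Ht.
        replace (- (q t * cos (th2 t) ^ 2) - - (q t * cos (th1 t) ^ 2)) with
          (- (q t * (cos (th2 t) ^ 2 - cos (th1 t) ^ 2))) by ring.
        rewrite Rabs_Ropp, Rabs_mult. apply Rmult_le_compat; try apply Rabs_pos; auto.
        eapply Rle_trans; [apply cos2_lipschitz|auto].
    - assert (Rabs (x - e) <= 2) by (apply Rabs_le; unfold Icc in *; lra).
      assert (0 <= Q * W) by now apply Rmult_le_pos. nra. }
  pose proof (logamp_oscillation _ _ _ x e P1 Hx He) as O1. apply Rabs_le_between in O1.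
  pose proof (logamp_oscillation _ _ _ x e P2 Hx He) as O2. apply Rabs_le_between in O2.
  unfold normalised.
  replace (exp (rho2 x - rho2 e) * sin (th2 x) - exp (rho1 x - rho1 e) * sin (th1 x)) with
    (exp (rho2 x - rho2 e) * (sin (th2 x) - sin (th1 x)) +
     (exp (rho2 x - rho2 e) - exp (rho1 x - rho1 e)) * sin (th1 x)) by ring.
  eapply Rle_trans; [apply Rabs_triang|]. rewrite !Rabs_mult.
  assert (A1 : Rabs (exp (rho2 x - rho2 e)) <= exp (2 * Q)).
  { rewrite Rabs_pos_eq by (left; apply exp_pos). apply exp_le_mono; lra. }
  assert (A2 : Rabs (sin (th2 x) - sin (th1 x)) <= W).
  { eapply Rle_trans; [apply sin_lipschitz|auto]. }
  assert (A3 : Rabs (exp (rho2 x - rho2 e) - exp (rho1 x - rho1 e)) <= exp (2 * Q) * (2 * Q * W)).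
  { eapply Rle_trans; [apply (exp_lipschitz _ _ (2 * Q)); lra|].
    apply Rmult_le_compat_l; [left; apply exp_pos|].
    replace (rho2 x - rho2 e - (rho1 x - rho1 e)) with ((rho2 x - rho1 x) - (rho2 e - rho1 e)) by ring.
    exact Hr. }
  assert (A4 : Rabs (sin (th1 x)) <= 1) by apply Rabs_le, SIN_bound.
  replace (cost * (Rabs (th2 (-1) - th1 (-1)) + (s2 - s1) * p1)) with
    (exp (2 * Q) * W + exp (2 * Q) * (2 * Q * W) * 1) by (unfold cost, W; ring).
  apply Rplus_le_compat; apply Rmult_le_compat; auto using Rabs_pos.
Qed.

(** * Nonlocal boundary conditions *)

Section BoundaryConditions.

Variables (m : pm -> nat) (eta alpha : pm -> nat -> R) (gamma : R).
Hypothesis eta_Icc : forall s i, (1 <= i <= m s)%nat -> Icc (eta s i).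
Hypothesis alpha_small : forall s, norm1 (m s) (alpha s) <= gamma.
Hypothesis gamma_small : 0 <= gamma <= threshold.

Definition bc (s : pm) (u : R -> R) : Prop :=
  u (pmR s) = sum_n_m (fun i => alpha s i * u (eta s i)) 1 (m s).

Lemma Icc_pmR s : Icc (pmR s).
Proof. destruct s; unfold Icc; simpl; lra. Qed.

Lemma bc_ext s u v : (forall x, Icc x -> u x = v x) -> bc s u -> bc s v.
Proof.
  intros E H. unfold bc. rewrite <- E by apply Icc_pmR. rewrite H.
  apply sum_n_m_ext_loc. intros i Hi. now rewrite E by auto.
Qed.

Lemma bc_linear s c d u v : bc s u -> bc s v -> bc s (fun x => c * u x + d * v x).
Proof.
  unfold bc. intros -> ->.
  change (plus (mult c (sum_n_m (fun i => alpha s i * u (eta s i)) 1 (m s)))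
               (mult d (sum_n_m (fun i => alpha s i * v (eta s i)) 1 (m s))) =
          sum_n_m (fun i => alpha s i * (c * u (eta s i) + d * v (eta s i))) 1 (m s)).
  rewrite <- !(sum_n_m_mult_l (K := R_Ring)), <- sum_n_m_plus.
  apply sum_n_m_ext_loc. intros i Hi. unfold mult, plus; simpl. ring.
Qed.

Lemma bc_scal s c u : bc s u -> bc s (fun x => c * u x).
Proof.
  intros H. apply bc_ext with (fun x => c * u x + 0 * u x); [intros; ring|].
  now apply bc_linear.
Qed.

Lemma nonlocal_sum_bound s u B :
  (forall x, Icc x -> Rabs (u x) <= B) ->
  Rabs (sum_n_m (fun i => alpha s i * u (eta s i)) 1 (m s)) <= gamma * B.
Proof.
  intros HB.
  assert (B0 : 0 <= B) by (eapply Rle_trans; [apply Rabs_pos|apply (HB _ (Icc_pmR s))]).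
  apply Rle_trans with (norm1 (m s) (alpha s) * B).
  2:{ now apply Rmult_le_compat_r. }
  unfold norm1.
  eapply Rle_trans; [apply (norm_sum_n_m (V := R_NormedModule))|].
  rewrite <- (sum_n_m_mult_r (K := R_Ring)).
  (* outside 1..m the points eta are arbitrary, so there the summand is
     replaced by its bound *)
  set (b := fun i => mult (Rabs (alpha s i)) B).
  rewrite (sum_n_m_ext_loc _ (fun i => if Compare_dec.le_dec 1 i then
     if Compare_dec.le_dec i (m s) then norm (alpha s i * u (eta s i)) else b i else b i)).
  2:{ intros i [H1 H2]. destruct Compare_dec.le_dec; [|lia]. destruct Compare_dec.le_dec; [reflexivity|lia]. }
  apply sum_n_m_le. intros i. destruct Compare_dec.le_dec; [|apply Rle_refl].
  destruct Compare_dec.le_dec; [|apply Rle_refl].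
  unfold norm, b, mult; simpl. unfold abs; simpl. rewrite Rabs_mult.
  apply Rmult_le_compat_l; [apply Rabs_pos|]. apply HB, eta_Icc; auto.
Qed.

(** The only way in which the smallness of the coefficients enters: the value at
    an endpoint is a small fraction of the size of the function. *)
Lemma bc_estimate s u B :
  bc s u -> (forall x, Icc x -> Rabs (u x) <= B) -> Rabs (u (pmR s)) <= gamma * B.
Proof. intros ->. apply nonlocal_sum_bound. Qed.

(** * Solutions satisfying the left boundary condition *)

Definition mode (th rho : R -> R) (x : R) : R := exp (rho x) * sin (th x).

Lemma mode_normalised th rho e x : mode th rho x = exp (rho e) * normalised th rho e x.
Proof.
  unfold mode, normalised. rewrite <- Rmult_assoc, <- exp_plus. do 2 f_equal. ring.
Qed.

Lemma bc_normalised s th rho e : bc s (mode th rho) <-> bc s (normalised th rho e).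
Proof.
  split; intros H.
  - apply bc_ext with (fun x => exp (- rho e) * mode th rho x); [|now apply bc_scal].
    intros x _. rewrite (mode_normalised th rho e), <- Rmult_assoc, <- exp_plus.
    rewrite Rplus_opp_l, exp_0. ring.
  - apply bc_ext with (fun x => exp (rho e) * normalised th rho e x); [|now apply bc_scal].
    intros x _. symmetry. apply mode_normalised.
Qed.

Lemma normalised_at_end th rho e : normalised th rho e e = sin (th e).
Proof. unfold normalised. rewrite Rminus_diag, exp_0. ring. Qed.

Lemma gamma_cost : 0 <= gamma * cost <= 1 / 8.
Proof.
  pose proof threshold_cost_le. pose proof cost_ge1. split.
  - apply Rmult_le_pos; lra.
  - apply Rle_trans with (threshold * cost); [|lra]. apply Rmult_le_compat_r; lra.
Qed.

Lemma gamma_le : gamma <= 1 / 8.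
Proof. pose proof gamma_cost. pose proof cost_ge1. nra. Qed.

Lemma gamma_exp : gamma * exp (2 * Q) <= 1 / 8.
Proof.
  pose proof gamma_cost. apply Rle_trans with (gamma * cost); [|lra].
  apply Rmult_le_compat_l; [lra|apply cost_ge].
Qed.

Lemma sin_end_small s t th rho :
  pruefer t th rho -> bc s (mode th rho) -> Rabs (sin (th (pmR s))) <= 1 / 2.
Proof.
  intros P H. apply (bc_normalised s th rho (pmR s)) in H.
  rewrite <- (normalised_at_end th rho (pmR s)).
  eapply Rle_trans; [apply (bc_estimate s _ (exp (2 * Q)) H)|].
  - intros x Hx. apply (normalised_bound t); auto. apply Icc_pmR.
  - pose proof gamma_exp. lra.
Qed.

(** Subtract the boundary conditions of the two normalised solutions: the sines
    of the end angles differ by at most gamma times the difference of the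
    solutions, and the sine is inverted with constant 2. *)
Lemma angle_end_difference s k s1 s2 th1 th2 rho1 rho2 :
  s1 <= s2 -> pruefer s1 th1 rho1 -> pruefer s2 th2 rho2 ->
  bc s (mode th1 rho1) -> bc s (mode th2 rho2) ->
  Rabs (th1 (pmR s) - INR k * PI) < PI / 2 -> Rabs (th2 (pmR s) - INR k * PI) < PI / 2 ->
  Rabs (th2 (pmR s) - th1 (pmR s))
   <= 2 * (gamma * (cost * (Rabs (th2 (-1) - th1 (-1)) + (s2 - s1) * p1))).
Proof.
  intros Hs P1 P2 B1 B2 K1 K2.
  eapply Rle_trans; [apply (sin_inverse_lipschitz k); eauto using sin_end_small|].
  apply Rmult_le_compat_l; [lra|].
  rewrite <- (normalised_at_end th1 rho1), <- (normalised_at_end th2 rho2).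
  apply (bc_normalised s th1 rho1 (pmR s)) in B1. apply (bc_normalised s th2 rho2 (pmR s)) in B2.
  apply (bc_estimate s (fun x => normalised th2 rho2 (pmR s) x - normalised th1 rho1 (pmR s) x)).
  - apply bc_ext with (fun x => 1 * normalised th2 rho2 (pmR s) x + (-1) * normalised th1 rho1 (pmR s) x);
      [intros; ring|]. now apply bc_linear.
  - intros x Hx. apply normalised_difference; auto using Icc_pmR.
Qed.

Definition defect (s : pm) (u : R -> R) : R :=
  u (pmR s) - sum_n_m (fun i => alpha s i * u (eta s i)) 1 (m s).

Lemma defect_bc s u : defect s u = 0 <-> bc s u.
Proof. unfold defect, bc. split; lra. Qed.

(** A solution with the left boundary condition.  The bound on the initial angle
    selects one of the two angles, differing by PI, of the same line of
    solutions. *)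
Definition left_mode (s : R) (th rho : R -> R) : Prop :=
  pruefer s th rho /\ bc Minus (mode th rho) /\ Rabs (th (-1)) < PI / 2.

(** The initial angle hardly moves with s, so the increase of the angle across
    the interval is not undone by the change of the initial angle. *)
Lemma left_mode_difference s1 s2 th1 th2 rho1 rho2 :
  s1 <= s2 -> left_mode s1 th1 rho1 -> left_mode s2 th2 rho2 ->
  Rabs (th2 (-1) - th1 (-1)) <= gain * (s2 - s1).
Proof.
  intros Hs (P1 & B1 & K1) (P2 & B2 & K2).
  apply (forced_initial_small gamma (s2 - s1) (fun x => th2 x - th1 x)); [lra|assumption|].
  apply (angle_end_difference Minus 0 s1 s2 th1 th2 rho1 rho2); auto;
    simpl; rewrite Rmult_0_l, Rminus_0_r; assumption.
Qed.

Lemma left_mode_lipschitz s1 s2 th1 th2 rho1 rho2 x :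
  s1 <= s2 -> left_mode s1 th1 rho1 -> left_mode s2 th2 rho2 -> Icc x ->
  Rabs (th2 x - th1 x) <= growth * (gain + p1) * (s2 - s1).
Proof.
  intros Hs M1 M2 Hx.
  pose proof (left_mode_difference _ _ _ _ _ _ Hs M1 M2) as H.
  destruct M1 as [P1 _], M2 as [P2 _].
  eapply Rle_trans.
  - apply (forced_bound (s2 - s1) (fun x => th2 x - th1 x)); [lra| |exact Hx].
    eapply angle_difference_forced; eassumption.
  - rewrite Rmult_assoc. pose proof growth_ge1. apply Rmult_le_compat_l; lra.
Qed.

Lemma left_mode_gain s1 s2 th1 th2 rho1 rho2 :
  s1 < s2 -> left_mode s1 th1 rho1 -> left_mode s2 th2 rho2 ->
  gain * (s2 - s1) < th2 1 - th1 1.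
Proof.
  intros Hs M1 M2.
  apply (forced_gain (s2 - s1) (fun x => th2 x - th1 x)); [lra| |].
  - destruct M1 as [P1 _], M2 as [P2 _]. eapply angle_difference_forced; eassumption.
  - eapply left_mode_difference; try eassumption. lra.
Qed.

Lemma left_mode_monotone s1 s2 th1 th2 rho1 rho2 :
  s1 <= s2 -> left_mode s1 th1 rho1 -> left_mode s2 th2 rho2 -> th1 1 <= th2 1.
Proof.
  intros [Hs|<-] M1 M2.
  - pose proof (left_mode_gain _ _ _ _ _ _ Hs M1 M2). pose proof gain_pos. nra.
  - pose proof (left_mode_lipschitz s1 s1 _ _ _ _ 1 (Rle_refl _) M1 M2 ltac:(unfold Icc; lra)) as H.
    rewrite Rminus_diag, Rmult_0_r in H. apply Rabs_le_between in H. lra.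
Qed.

(** For s = 0 the angle 0 is constant and the corresponding u vanishes
    identically, which satisfies every boundary condition. *)
Lemma left_mode_zero : exists rho, left_mode 0 (fun _ => 0) rho.
Proof.
  exists (fun x => 0 + RInt (fun t => - (q t * cos 0 ^ 2)) (-1) x). split; [split|split].
  - intros x _. rewrite sin_0. evar_last; [apply (is_derive_const (V := R_NormedModule))|].
    unfold zero; simpl. ring.
  - intros x _. apply (is_derive_primitive (fun t => - (q t * cos 0 ^ 2))).
    intros t. apply (continuous_opp (V := R_NormedModule)).
    apply (continuous_mult (K := R_AbsRing)); [apply q_continuous|apply continuous_const].
  - apply bc_ext with (fun x => 0 * x + 0 * x).
    + intros x _. unfold mode. rewrite sin_0. ring.
    + unfold bc. rewrite (sum_n_m_ext_loc _ (fun _ => zero)).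
      * rewrite sum_n_m_const_zero. change zero with 0. ring.
      * intros i _. change (alpha Minus i * (0 * eta Minus i + 0 * eta Minus i) = 0). ring.
  - rewrite Rabs_R0. pose proof PI_RGT_0. lra.
Qed.

(** * Eigenmodes: uniqueness, order and existence *)

(** An eigenfunction of index k with eigenvalue s^2, except for k = 0 where s and
    u vanish. *)
Definition eigenmode (k : nat) (s : R) (th rho : R -> R) : Prop :=
  left_mode s th rho /\ bc Plus (mode th rho) /\ Rabs (th 1 - INR k * PI) < PI / 2.

Lemma eigenmode_unique k s1 s2 th1 th2 rho1 rho2 :
  eigenmode k s1 th1 rho1 -> eigenmode k s2 th2 rho2 -> s1 = s2.
Proof.
  revert s1 s2 th1 th2 rho1 rho2.
  assert (W : forall s1 s2 th1 th2 rho1 rho2, s1 <= s2 ->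
    eigenmode k s1 th1 rho1 -> eigenmode k s2 th2 rho2 -> s1 = s2).
  { intros s1 s2 th1 th2 rho1 rho2 Hs (M1 & R1 & K1) (M2 & R2 & K2).
    destruct M1 as (P1 & B1 & I1), M2 as (P2 & B2 & I2).
    assert (s2 - s1 = 0); [|lra].
    apply (forced_rigidity gamma (s2 - s1) (fun x => th2 x - th1 x)); [lra|assumption| |].
    - eapply angle_difference_forced; eassumption.
    - intros [|].
      + apply (angle_end_difference Minus 0 s1 s2 th1 th2 rho1 rho2); auto;
          simpl; rewrite Rmult_0_l, Rminus_0_r; assumption.
      + now apply (angle_end_difference Plus k s1 s2 th1 th2 rho1 rho2). }
  intros s1 s2 th1 th2 rho1 rho2 M1 M2. destruct (Rle_dec s1 s2).
  - eauto.
  - symmetry. apply (W s2 s1 th2 th1 rho2 rho1); auto. lra.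
Qed.

Lemma eigenmode_pos k s th rho : (1 <= k)%nat -> eigenmode k s th rho -> 0 < s.
Proof.
  intros Hk (M & _ & K). destruct (Rlt_le_dec 0 s) as [|Hs]; [assumption|exfalso].
  destruct left_mode_zero as [rho0 M0].
  pose proof (left_mode_monotone _ _ _ _ _ _ Hs M M0). simpl in H.
  apply Rabs_def2 in K. apply le_INR in Hk. simpl in Hk. pose proof PI_RGT_0. nra.
Qed.

Lemma eigenmode_increasing j k s1 s2 th1 th2 rho1 rho2 :
  (j < k)%nat -> eigenmode j s1 th1 rho1 -> eigenmode k s2 th2 rho2 -> s1 < s2.
Proof.
  intros Hk (M1 & _ & K1) (M2 & _ & K2). destruct (Rlt_le_dec s1 s2) as [|Hs]; [assumption|exfalso].
  pose proof (left_mode_monotone _ _ _ _ _ _ Hs M2 M1).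
  apply Rabs_def2 in K1, K2. apply le_INR in Hk. rewrite S_INR in Hk. pose proof PI_RGT_0. nra.
Qed.

(** The end angle is a Lipschitz function of s that vanishes at s = 0; so the
    parameters grow at least linearly in k. *)
Lemma eigenmode_growth k s th rho :
  (1 <= k)%nat -> eigenmode k s th rho -> INR k * PI - PI / 2 < growth * (gain + p1) * s.
Proof.
  intros Hk M. pose proof (eigenmode_pos k s th rho Hk M) as Hs.
  destruct M as (M & _ & K). destruct left_mode_zero as [rho0 M0].
  pose proof (left_mode_lipschitz 0 s _ _ _ _ 1 ltac:(lra) M0 M ltac:(unfold Icc; lra)) as H.
  rewrite !Rminus_0_r in H. apply Rabs_le_between in H. apply Rabs_def2 in K. lra.
Qed.

(** Used with B proportional to a distance of parameters: the defect is Lipschitz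
    in them. *)
Lemma defect_difference s u v B :
  (forall x, Icc x -> Rabs (u x - v x) <= B) -> Rabs (defect s u - defect s v) <= 2 * B.
Proof.
  intros H. pose proof (nonlocal_sum_bound s (fun x => u x - v x) B H) as Hs.
  pose proof (H _ (Icc_pmR s)) as He. pose proof gamma_le as Hg.
  assert (E : defect s u - defect s v = (u (pmR s) - v (pmR s)) -
     sum_n_m (fun i => alpha s i * (u (eta s i) - v (eta s i))) 1 (m s)).
  { unfold defect.
    rewrite (sum_n_m_ext_loc (fun i => alpha s i * u (eta s i))
      (fun i => plus (alpha s i * (u (eta s i) - v (eta s i))) (alpha s i * v (eta s i)))).
    - rewrite sum_n_m_plus. unfold plus; simpl. ring.
    - intros i _. unfold plus; simpl. ring. }
  rewrite E. eapply Rle_trans; [apply Rabs_triang|]. rewrite Rabs_Ropp.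
  pose proof (Rabs_pos (u (pmR s) - v (pmR s))). nra.
Qed.

(** At the initial angles PI/2 and -PI/2 the value at -1 is 1 and -1, which
    dominates the nonlocal sum, so the defect changes sign in between. *)
Lemma left_mode_exists s : exists thrho, left_mode s (fst thrho) (snd thrho).
Proof.
  pose proof PI_RGT_0 as Hpi.
  set (u := fun phi => normalised (angle s phi) (logamp s phi) (-1)).
  assert (Hu : forall phi, u phi (-1) = sin phi).
  { intros phi. unfold u. rewrite normalised_at_end. now rewrite angle_initial. }
  assert (Hsum : forall phi, Rabs (sum_n_m (fun i => alpha Minus i * u phi (eta Minus i)) 1 (m Minus)) <= 1 / 8).
  { intros phi. eapply Rle_trans; [apply (nonlocal_sum_bound Minus (u phi) (exp (2 * Q)))|apply gamma_exp].
    intros x Hx. apply (normalised_bound s); auto using pruefer_angle. unfold Icc; lra. }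
  assert (C : continuity (fun phi => defect Minus (u phi))).
  { intros phi. apply continuity_pt_filterlim.
    apply (lipschitz_continuous (fun phi => defect Minus (u phi)) (2 * cost)). intros a b.
    rewrite Rmult_assoc. apply defect_difference. intros x Hx.
    eapply Rle_trans; [apply (normalised_difference s s); auto using pruefer_angle; [lra|unfold Icc; lra]|].
    rewrite !angle_initial. right; ring. }
  destruct (IVT_gen (fun phi => defect Minus (u phi)) (- (PI / 2)) (PI / 2) 0 C) as [phi [Hphi Hz]].
  { pose proof (Hsum (PI / 2)) as H1. pose proof (Hsum (- (PI / 2))) as H2.
    apply Rabs_le_between in H1, H2. unfold defect. simpl pmR. rewrite !Hu, sin_neg, sin_PI2.
    split; [eapply Rle_trans; [apply Rmin_l|]|eapply Rle_trans; [|apply Rmax_r]]; lra. }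
  rewrite Rmin_left, Rmax_right in Hphi by lra.
  exists (angle s phi, logamp s phi). simpl fst; simpl snd. split; [apply pruefer_angle|].
  split; [apply (bc_normalised _ _ _ (-1)); now apply defect_bc|].
  rewrite angle_initial. unfold defect in Hz. simpl pmR in Hz. rewrite Hu in Hz.
  pose proof (Hsum phi) as H. apply Rabs_le_between in H.
  apply Rabs_def1.
  - destruct (Req_dec phi (PI / 2)) as [E|]; [|lra]. rewrite E, sin_PI2 in Hz.
    rewrite <- E in Hz. lra.
  - destruct (Req_dec phi (- (PI / 2))) as [E|]; [|lra].
    rewrite E in Hz at 1. rewrite sin_neg, sin_PI2 in Hz. lra.
Qed.

(** The end angle Th is onto, so it takes the values k PI - PI/2 and k PI + PI/2.
    At these two the normalised solution takes the values 1 and -1 at the right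
    end, in an order depending on k, which dominates the nonlocal sum, and the intermediate value theorem applies to the
    defect in the parameter s. *)
Lemma eigenmode_exists k : exists sthrho : R * ((R -> R) * (R -> R)),
  eigenmode k (fst sthrho) (fst (snd sthrho)) (snd (snd sthrho)).
Proof.
  pose proof PI_RGT_0 as Hpi. pose proof gain_pos as Hg. pose proof p1_pos as Hp.
  pose proof growth_ge1 as Hgr. pose proof cost_ge1 as Hc.
  set (T := fun s => proj1_sig (constructive_indefinite_description _ (left_mode_exists s))).
  assert (HT : forall s, left_mode s (fst (T s)) (snd (T s))).
  { intros s. unfold T. destruct constructive_indefinite_description as [y Hy]. exact Hy. }
  set (Th := fun s => fst (T s) 1).
  assert (CTh : continuity Th).
  { intros s. apply continuity_pt_filterlim.
    apply (lipschitz_continuous _ (growth * (gain + p1))).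
    assert (W : forall a b, a <= b -> Rabs (Th b - Th a) <= growth * (gain + p1) * (b - a)).
    { intros a b Hab. apply (left_mode_lipschitz a b _ _ _ _ 1 Hab (HT a) (HT b)).
      unfold Icc; lra. }
    intros a b. destruct (Rle_dec a b).
    - rewrite (Rabs_minus_sym a b), (Rabs_pos_eq (b - a)), Rabs_minus_sym by lra. auto.
    - rewrite (Rabs_pos_eq (a - b)) by lra. apply W; lra. }
  assert (Th_range : forall y, exists s, Th s = y).
  { intros y. destruct left_mode_zero as [rho0 M0].
    (* the end angle has slope at least gain in s, so it covers y on [-b, b] *)
    set (b := (Rabs y + 1) / gain).
    assert (Hy := Rabs_pos y).
    assert (Hb : 0 < b) by (apply Rdiv_lt_0_compat; lra).
    assert (Eb : gain * b = Rabs y + 1) by (unfold b; field; lra).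
    pose proof (left_mode_gain 0 b _ _ _ _ Hb M0 (HT b)) as H1.
    pose proof (left_mode_gain (- b) 0 _ _ _ _ ltac:(lra) (HT (- b)) M0) as H2.
    simpl in H1, H2. fold (Th b) in H1. fold (Th (- b)) in H2.
    pose proof (Rle_abs y). pose proof (Rle_abs (- y)). rewrite Rabs_Ropp in H0.
    destruct (IVT_gen Th (- b) b y CTh) as [s [_ Hs]]; [|now exists s].
    split; [eapply Rle_trans; [apply Rmin_l|]|eapply Rle_trans; [|apply Rmax_r]]; lra. }
  destruct (Th_range (INR k * PI - PI / 2)) as [a Ha].
  destruct (Th_range (INR k * PI + PI / 2)) as [b Hb].
  assert (Hab : a < b).
  { destruct (Rlt_le_dec a b) as [|Hba]; [assumption|].
    pose proof (left_mode_monotone b a _ _ _ _ Hba (HT b) (HT a)) as H.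
    fold (Th a) in H. fold (Th b) in H. lra. }
  set (u := fun s => normalised (fst (T s)) (snd (T s)) 1).
  assert (Hu : forall s, u s 1 = sin (Th s))
    by (intros s; exact (normalised_at_end (fst (T s)) (snd (T s)) 1)).
  assert (Hsum : forall s, Rabs (sum_n_m (fun i => alpha Plus i * u s (eta Plus i)) 1 (m Plus)) <= 1 / 8).
  { intros s. eapply Rle_trans; [apply (nonlocal_sum_bound Plus (u s) (exp (2 * Q)))|apply gamma_exp].
    intros x Hx. destruct (HT s) as [P _]. apply (normalised_bound s); auto. unfold Icc; lra. }
  assert (C : continuity (fun s => defect Plus (u s))).
  { intros s. apply continuity_pt_filterlim.
    apply (lipschitz_continuous (fun s => defect Plus (u s)) (2 * (cost * (gain + p1)))).
    assert (W : forall a b, a <= b ->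
       Rabs (defect Plus (u b) - defect Plus (u a)) <= 2 * (cost * (gain + p1)) * (b - a)).
    { intros a' b' Hab'. rewrite Rmult_assoc. apply defect_difference. intros x Hx.
      pose proof (left_mode_difference _ _ _ _ _ _ Hab' (HT a') (HT b')) as H.
      destruct (HT a') as [Pa _], (HT b') as [Pb _].
      eapply Rle_trans; [apply (normalised_difference a' b'); auto; unfold Icc; lra|].
      rewrite Rmult_assoc. apply Rmult_le_compat_l; lra. }
    intros x y. destruct (Rle_dec x y).
    - rewrite (Rabs_minus_sym x y), (Rabs_pos_eq (y - x)), Rabs_minus_sym by lra. auto.
    - rewrite (Rabs_pos_eq (x - y)) by lra. apply W; lra. }
  assert (Da : defect Plus (u a) = - (-1) ^ k - sum_n_m (fun i => alpha Plus i * u a (eta Plus i)) 1 (m Plus)).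
  { unfold defect. simpl pmR. rewrite Hu, Ha.
    replace (INR k * PI - PI / 2) with (- (PI / 2) + INR k * PI) by ring.
    rewrite sin_shift, sin_neg, sin_PI2. ring. }
  assert (Db : defect Plus (u b) = (-1) ^ k - sum_n_m (fun i => alpha Plus i * u b (eta Plus i)) 1 (m Plus)).
  { unfold defect. simpl pmR. rewrite Hu, Hb.
    replace (INR k * PI + PI / 2) with (PI / 2 + INR k * PI) by ring.
    rewrite sin_shift, sin_PI2. ring. }
  pose proof (Hsum a) as Sa. pose proof (Hsum b) as Sb. apply Rabs_le_between in Sa, Sb.
  assert (Hk : (-1) ^ k = 1 \/ (-1) ^ k = -1).
  { pose proof (pow_1_abs k) as H. unfold Rabs in H. destruct Rcase_abs; lra. }
  destruct (IVT_gen (fun s => defect Plus (u s)) a b 0 C) as [s [Hs Hz]].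
  { rewrite Da, Db. unfold Rmin, Rmax. destruct Hk as [-> | ->]; repeat destruct Rle_dec; lra. }
  rewrite Rmin_left, Rmax_right in Hs by lra.
  exists (s, T s). simpl fst; simpl snd. split; [apply HT|]. split.
  { apply (bc_normalised _ _ _ 1). now apply defect_bc. }
  assert (s <> a) by (intros ->; destruct Hk; lra).
  assert (s <> b) by (intros ->; destruct Hk; lra).
  pose proof (left_mode_gain a s _ _ _ _ ltac:(lra) (HT a) (HT s)) as H1.
  pose proof (left_mode_gain s b _ _ _ _ ltac:(lra) (HT s) (HT b)) as H2.
  fold (Th s) (Th a) in H1. fold (Th s) (Th b) in H2.
  fold (Th s). apply Rabs_def1; nra.
Qed.

(** * The resonant equation and simplicity *)

Section Solutions.

Variables (s : R) (th rho : R -> R) (V V' : R -> R) (c : R).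
Hypothesis s_pos : 0 < s.
Hypothesis P : pruefer s th rho.
Hypothesis DV : forall x, Icc x -> is_derive V x (V' x).
Hypothesis DV' : forall x, Icc x ->
  is_derive V' x (- (s ^ 2 * p x ^ 2 * (V x + c * mode th rho x))).

(** The component of (V, V' / (s p)) orthogonal to the solution, relative to its
    amplitude.  The correction by sin cos turns the oscillating forcing
    c s p (sin th)^2 into c s p / 2, so that this is the derivative of the
    angle with respect to the parameter when s increases at the rate c s / 2. *)
Definition lin_angle (x : R) : R :=
  exp (- rho x) * (V x * cos (th x) - V' x / (s * p x) * sin (th x))
  + c / 2 * (sin (th x) * cos (th x)).

(** The component along the solution; the two corrections cancel in
    [solution_polar]. *)
Definition lin_amp (x : R) : R :=
  exp (- rho x) * (V x * sin (th x) + V' x / (s * p x) * cos (th x))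
  - c / 2 * cos (th x) ^ 2.

Lemma solution_polar x : V x = exp (rho x) * (lin_amp x * sin (th x) + lin_angle x * cos (th x)).
Proof.
  unfold lin_amp, lin_angle.
  pose proof (sin2_cos2 (th x)) as E. unfold Rsqr in E.
  assert (E' : sin (th x) ^ 2 = 1 - cos (th x) ^ 2) by lra.
  assert (Ex : exp (rho x) * exp (- rho x) = 1) by (rewrite <- exp_plus, Rplus_opp_r; apply exp_0).
  set (e := V' x / (s * p x)).
  transitivity (exp (rho x) * exp (- rho x) * V x); [rewrite Ex; ring|]. ring [E'].
Qed.

Lemma lin_angle_derive x : Icc x ->
  is_derive lin_angle x (q x * cos (2 * th x) * lin_angle x + c * s / 2 * p x).
Proof.
  intros Hx. destruct P as [Dt Dr].
  pose proof (p_bounds x Hx) as Hp.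
  evar_last.
  - unfold lin_angle. auto_derive; [|reflexivity].
    repeat split; try (eexists; eauto); nra.
  - rewrite (derive_eq V x _ (DV x Hx)), (derive_eq V' x _ (DV' x Hx)),
      (derive_eq th x _ (Dt x Hx)), (derive_eq rho x _ (Dr x Hx)),
      (derive_eq p x _ (p_derive x)).
    unfold lin_angle, mode. rewrite cos_2a.
    pose proof (sin2_cos2 (th x)) as E. unfold Rsqr in E.
    assert (E' : sin (th x) ^ 2 = 1 - cos (th x) ^ 2) by lra.
    rewrite exp_Ropp. pose proof (exp_pos (rho x)).
    field [E']. lra.
Qed.

Lemma lin_amp_derive x : Icc x ->
  is_derive lin_amp x (q x * sin (2 * th x) * lin_angle x).
Proof.
  intros Hx. destruct P as [Dt Dr].
  pose proof (p_bounds x Hx) as Hp.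
  evar_last.
  - unfold lin_amp. auto_derive; [|reflexivity].
    repeat split; try (eexists; eauto); nra.
  - rewrite (derive_eq V x _ (DV x Hx)), (derive_eq V' x _ (DV' x Hx)),
      (derive_eq th x _ (Dt x Hx)), (derive_eq rho x _ (Dr x Hx)),
      (derive_eq p x _ (p_derive x)).
    unfold lin_angle, mode. rewrite sin_2a.
    pose proof (sin2_cos2 (th x)) as E. unfold Rsqr in E.
    assert (E' : sin (th x) ^ 2 = 1 - cos (th x) ^ 2) by lra.
    rewrite exp_Ropp. pose proof (exp_pos (rho x)).
    field [E']. lra.
Qed.

Lemma lin_angle_forced : forced (c * s / 2) lin_angle.
Proof.
  exists (fun x => q x * cos (2 * th x) * lin_angle x + c * s / 2 * p x). split.
  - exact lin_angle_derive.
  - intros x Hx.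
    replace (q x * cos (2 * th x) * lin_angle x + c * s / 2 * p x - c * s / 2 * p x)
      with (q x * cos (2 * th x) * lin_angle x) by ring.
    rewrite !Rabs_mult. apply Rmult_le_compat_r; [apply Rabs_pos|].
    assert (Rabs (cos (2 * th x)) <= 1) by apply Rabs_le, COS_bound.
    pose proof (q_bound x Hx). pose proof (Rabs_pos (q x)).
    pose proof (Rabs_pos (cos (2 * th x))). nra.
Qed.

Lemma lin_amp_oscillation W x e :
  (forall t, Icc t -> Rabs (lin_angle t) <= W) -> Icc x -> Icc e ->
  Rabs (lin_amp x - lin_amp e) <= 2 * Q * W.
Proof.
  intros HW Hx He. pose proof Q_nonneg as HQ.
  assert (HW0 : 0 <= W) by (eapply Rle_trans; [apply Rabs_pos|apply (HW x Hx)]).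
  apply Rle_trans with (Q * W * Rabs (x - e)).
  - apply (lipschitz_Icc lin_amp (fun x => q x * sin (2 * th x) * lin_angle x)); auto.
    + exact lin_amp_derive.
    + intros t Ht. rewrite !Rabs_mult. apply Rmult_le_compat; auto using Rabs_pos.
      * apply Rmult_le_pos; apply Rabs_pos.
      * assert (Rabs (sin (2 * th t)) <= 1) by apply Rabs_le, SIN_bound.
        pose proof (q_bound t Ht). pose proof (Rabs_pos (q t)).
        pose proof (Rabs_pos (sin (2 * th t))). nra.
  - assert (Rabs (x - e) <= 2) by (apply Rabs_le; unfold Icc in *; lra).
    assert (0 <= Q * W) by now apply Rmult_le_pos. nra.
Qed.

(** Subtracting a multiple of the mode from V, which preserves the boundary
    condition, removes the component along the mode at the endpoint e.  What
    remains there is the linearised angle times cos th, and |cos th| >= 1/2. *)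
Lemma lin_angle_end e : 0 <= c -> bc e (mode th rho) -> bc e V ->
  Rabs (lin_angle (pmR e))
    <= 2 * (gamma * (cost * (Rabs (lin_angle (-1)) + c * s / 2 * p1))).
Proof.
  intros Hc Bm BV. pose proof Q_nonneg as HQ. pose proof (Icc_pmR e) as He.
  set (W := growth * (Rabs (lin_angle (-1)) + c * s / 2 * p1)).
  assert (HW : forall t, Icc t -> Rabs (lin_angle t) <= W).
  { intros t Ht. apply forced_bound; auto using lin_angle_forced. nra. }
  assert (HW0 : 0 <= W) by (eapply Rle_trans; [apply Rabs_pos|apply (HW _ He)]).
  (* V minus a multiple of the mode, divided by the amplitude at e *)
  set (d := fun x => exp (- rho (pmR e)) * V x
                     + (- exp (- rho (pmR e)) * lin_amp (pmR e)) * mode th rho x).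
  assert (Ed : forall x, d x = exp (rho x - rho (pmR e)) *
     ((lin_amp x - lin_amp (pmR e)) * sin (th x) + lin_angle x * cos (th x))).
  { intros x. unfold d. rewrite (solution_polar x). unfold mode.
    unfold Rminus at 1. rewrite exp_plus. ring. }
  assert (Hd : Rabs (d (pmR e)) <= gamma * (exp (2 * Q) * (2 * Q * W + W))).
  { apply bc_estimate; [now apply bc_linear|]. intros x Hx. rewrite Ed, Rabs_mult.
    pose proof (logamp_oscillation s th rho x _ P Hx He) as Hr. apply Rabs_le_between in Hr.
    apply Rmult_le_compat; try apply Rabs_pos.
    - rewrite Rabs_pos_eq by (left; apply exp_pos). apply exp_le_mono; lra.
    - eapply Rle_trans; [apply Rabs_triang|]. rewrite !Rabs_mult.
      pose proof (lin_amp_oscillation W x _ HW Hx He). pose proof (HW x Hx).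
      assert (Rabs (sin (th x)) <= 1) by apply Rabs_le, SIN_bound.
      assert (Rabs (cos (th x)) <= 1) by apply Rabs_le, COS_bound.
      assert (forall a b, Rabs b <= 1 -> Rabs a * Rabs b <= Rabs a).
      { intros a b Hb. pose proof (Rabs_pos a). nra. }
      apply Rplus_le_compat; eapply Rle_trans; eauto. }
  rewrite Ed, !Rminus_diag, exp_0, Rmult_0_l, Rplus_0_l, Rmult_1_l, Rabs_mult in Hd.
  pose proof (cos_lower_bound _ (sin_end_small e s th rho P Bm)) as Hcos.
  replace (cost * (Rabs (lin_angle (-1)) + c * s / 2 * p1)) with (exp (2 * Q) * (2 * Q * W + W))
    by (unfold cost, W; ring).
  pose proof (Rabs_pos (lin_angle (pmR e))). nra.
Qed.

(** Uniqueness for the linear equation: the orthogonal component vanishes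
    identically once it does at -1, and then the other component is constant. *)
Lemma solution_multiple_of_angle_zero :
  c = 0 -> lin_angle (-1) = 0 -> exists a, forall x, Icc x -> V x = a * mode th rho x.
Proof.
  intros Hc H0.
  assert (HW : forall t, Icc t -> Rabs (lin_angle t) <= 0).
  { intros t Ht. replace 0 with (growth * (Rabs (lin_angle (-1)) + c * s / 2 * p1)).
    - apply forced_bound; auto using lin_angle_forced. rewrite Hc. lra.
    - rewrite H0, Hc, Rabs_R0. field. }
  exists (lin_amp (-1)). intros x Hx. rewrite (solution_polar x).
  pose proof (lin_amp_oscillation 0 x (-1) HW Hx ltac:(unfold Icc; lra)) as Ha.
  rewrite Rmult_0_r in Ha.
  assert (Z : forall t, Rabs t <= 0 -> t = 0).
  { intros t Ht. apply Rabs_le_between in Ht. lra. }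
  apply Z in Ha. rewrite (Z _ (HW x Hx)). replace (lin_amp x) with (lin_amp (-1)) by lra.
  unfold mode. ring.
Qed.

(** With c <> 0 the forcing c s / 2 is positive, against [forced_rigidity]. *)
Lemma resonant_solution :
  0 <= c -> (forall e, bc e (mode th rho)) -> (forall e, bc e V) ->
  c = 0 /\ exists a, forall x, Icc x -> V x = a * mode th rho x.
Proof.
  intros Hc Bm BV.
  assert (Hs : 0 <= c * s / 2) by nra.
  assert (E : c * s / 2 = 0).
  { apply (forced_rigidity gamma (c * s / 2) lin_angle); auto using lin_angle_forced.
    intros e. now apply lin_angle_end. }
  assert (Ec : c = 0) by nra.
  split; [assumption|]. apply solution_multiple_of_angle_zero; [assumption|].
  pose proof (forced_initial_small gamma (c * s / 2) lin_angle Hs gamma_small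
     (lin_angle_end Minus Hc (Bm Minus) (BV Minus))) as H.
  rewrite E, Rmult_0_r in H. apply Rabs_le_between in H. lra.
Qed.

End Solutions.

Lemma eigenmode_bc k s th rho e : eigenmode k s th rho -> bc e (mode th rho).
Proof. intros ((_ & B1 & _) & B2 & _). now destruct e. Qed.

(** The sign of c is free because V may be replaced by - V. *)
Lemma eigenmode_simple k s th rho (V V' : R -> R) c :
  (1 <= k)%nat -> eigenmode k s th rho ->
  (forall x, Icc x -> is_derive V x (V' x)) ->
  (forall x, Icc x -> is_derive V' x (- (s ^ 2 * p x ^ 2 * (V x + c * mode th rho x)))) ->
  (forall e, bc e V) ->
  c = 0 /\ exists a, forall x, Icc x -> V x = a * mode th rho x.
Proof.
  intros Hk M D D' B. pose proof (eigenmode_pos k s th rho Hk M) as Hs.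
  assert (P : pruefer s th rho) by apply M.
  assert (Bm : forall e, bc e (mode th rho)) by (intros e; eapply eigenmode_bc, M).
  destruct (Rle_dec 0 c) as [Hc|Hc].
  - now apply resonant_solution with s V'.
  - destruct (resonant_solution s th rho (fun x => - V x) (fun x => - V' x) (- c)) as [E _]; auto.
    + intros x Hx. apply (is_derive_opp (V := R_NormedModule)); auto.
    + intros x Hx. evar_last; [apply (is_derive_opp (V := R_NormedModule)), D', Hx|].
      unfold opp; simpl. ring.
    + lra.
    + intros e. apply bc_ext with (fun x => (-1) * V x); [intros; ring|]. now apply bc_scal.
    + lra.
Qed.

(** The trivial reference solution is an eigenmode of index 0, and there is only
    one parameter per index. *)
Lemma eigenmode_zero s th rho : eigenmode 0 s th rho -> s = 0.
Proof.
  intros M. destruct left_mode_zero as [rho0 M0].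
  apply (eigenmode_unique 0 s 0 th (fun _ => 0) rho rho0); [assumption|].
  split; [assumption|]. split.
  - apply bc_ext with (fun x => 0 * mode th rho x).
    + intros x _. unfold mode. rewrite sin_0. ring.
    + apply bc_scal, M.
  - simpl. rewrite Rmult_0_l, Rminus_0_r, Rabs_R0. pose proof PI_RGT_0. lra.
Qed.

(** Start the Pruefer angle in the direction of the Cauchy data of V at -1; then V
    is a multiple of the mode, which inherits the boundary conditions.  The end
    angle is nonnegative because s > 0, so it falls into the interval of some k,
    and k = 0 would force s = 0. *)
Lemma eigensolution_is_mode s (V V' : R -> R) :
  0 < s ->
  (forall x, Icc x -> is_derive V x (V' x)) ->
  (forall x, Icc x -> is_derive V' x (- (s ^ 2 * p x ^ 2 * V x))) ->
  (forall e, bc e V) -> (exists x, Icc x /\ V x <> 0) ->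
  exists k th rho, (1 <= k)%nat /\ eigenmode k s th rho.
Proof.
  intros Hs D D' B [x0 [Hx0 Hn]].
  assert (Hp : 0 < p (-1)) by (pose proof (p_bounds (-1) ltac:(unfold Icc; lra)); lra).
  destruct (direction_angle (V (-1)) (V' (-1) / (s * p (-1)))) as [phi [Hphi E]].
  pose proof (pruefer_angle s phi) as P. pose proof (angle_initial s phi) as I.
  set (th := angle s phi) in *. set (rho := logamp s phi) in *.
  destruct (solution_multiple_of_angle_zero s th rho V V' 0) as [a Ha]; auto.
  { intros x Hx. replace (V x + 0 * mode th rho x) with (V x) by ring. auto. }
  { unfold lin_angle. rewrite I, E. field. }
  assert (a <> 0) by (intros ->; apply Hn; rewrite Ha by assumption; ring).
  assert (Bm : forall e, bc e (mode th rho)).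
  { intros e. apply bc_ext with (fun x => / a * V x); [|now apply bc_scal].
    intros x Hx. rewrite Ha by assumption. field. assumption. }
  assert (M : left_mode s th rho).
  { split; [assumption|]. split; [apply Bm|]. rewrite I.
    pose proof (sin_end_small Minus s th rho P (Bm Minus)) as Hsin. simpl in Hsin. rewrite I in Hsin.
    apply Rabs_def1; [|lra]. destruct (Req_dec phi (PI / 2)) as [Ep|]; [|lra].
    rewrite Ep, sin_PI2, Rabs_R1 in Hsin. lra. }
  destruct left_mode_zero as [rho0 M0].
  destruct (small_sin_index (th 1)) as [k Hk].
  { apply (left_mode_monotone 0 s _ _ _ _ ltac:(lra) M0 M). }
  { apply (sin_end_small Plus s th rho P (Bm Plus)). }
  assert (EM : eigenmode k s th rho) by (split; [assumption|split; [apply Bm|assumption]]).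
  exists k, th, rho. split; [|assumption].
  destruct k; [|lia]. apply eigenmode_zero in EM. lra.
Qed.

(** * Critical points of an eigenfunction *)

(** Where cos th = 0 the term with q drops out of the equation and th' = s p > 0. *)
Lemma angle_crosses_upward s th rho x y a :
  0 < s -> pruefer s th rho -> cos a = 0 -> Icc x -> Icc y -> x < y -> a <= th x -> a < th y.
Proof.
  intros Hs [D _] Ha Hx Hy Hxy H.
  assert (0 < th y - a); [|lra].
  apply (positive_of_crossing_upward (fun t => th t - a)
     (fun t => s * p t + q t * (sin (th t) * cos (th t))) x 1); [| |intros t Ht E|].
  - intros t Ht. evar_last.
    + apply (is_derive_minus (V := R_NormedModule)); [apply D; unfold Icc in *; lra|].
      apply (is_derive_const (V := R_NormedModule)).
    + unfold minus, plus, opp, zero; simpl. ring.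
  - lra.
  - replace (th t) with a by lra. rewrite Ha.
    pose proof (p_bounds t ltac:(unfold Icc in *; lra)). nra.
  - unfold Icc in Hy. lra.
Qed.

(** The angle starts below PI/2 and ends between k PI - PI/2 and k PI + PI/2, so
    it passes through PI/2 + j PI once for each j < k and through no other
    zero of the cosine. *)
Lemma eigenmode_critical_points k s th rho :
  (1 <= k)%nat -> eigenmode k s th rho ->
  exists zs : list R, NoDup zs /\ length zs = k /\
    forall x, In x zs <-> Ioo x /\ cos (th x) = 0.
Proof.
  intros Hk M. pose proof (eigenmode_pos _ _ _ _ Hk M) as Hs.
  destruct M as ((P & _ & I) & _ & K). pose proof PI_RGT_0 as Hpi.
  apply Rabs_def2 in I, K.
  (* the zeros of the cosine, the j-th critical point being where th = a j *)
  set (a := fun j => PI / 2 + INR j * PI).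
  assert (Ca : forall j, cos (a j) = 0).
  { intros j. unfold a. rewrite cos_sin.
    replace (PI / 2 + (PI / 2 + INR j * PI)) with (PI + INR j * PI) by field.
    rewrite sin_shift, sin_PI. ring. }
  assert (Cth : forall t, continuous (fun t => th (clamp t)) t).
  { apply C0_clamp_continuous, continuous_C0. intros t Ht. apply (is_derive_continuous th t _ (proj1 P t Ht)). }
  assert (IO : forall y, Ioo y -> Icc y) by (unfold Ioo, Icc; intros; lra).
  assert (Ie : Icc (-1) /\ Icc 1) by (unfold Icc; lra). destruct Ie as [Im Ip].
  assert (Ex : forall j, exists z, (j < k)%nat -> Ioo z /\ th z = a j).
  { intros j. destruct (Compare_dec.lt_dec j k) as [Hj|]; [|exists 0; lia].
    apply le_INR in Hj. rewrite S_INR in Hj. pose proof (pos_INR j).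
    destruct (IVT_gen (fun t => th (clamp t)) (-1) 1 (a j)) as [z [Hz E]].
    - intros t. apply continuity_pt_filterlim, Cth.
    - rewrite !clamp_id by assumption. unfold a.
      split; [eapply Rle_trans; [apply Rmin_l|]|eapply Rle_trans; [|apply Rmax_r]]; nra.
    - rewrite Rmin_left, Rmax_right in Hz by lra. rewrite clamp_id in E by exact Hz.
      exists z. intros _. split; [|assumption].
      assert (z <> -1) by (intros ->; unfold a in E; nra).
      assert (z <> 1) by (intros ->; unfold a in E; nra).
      unfold Ioo; lra. }
  set (z := fun j => proj1_sig (constructive_indefinite_description _ (Ex j))).
  assert (Hz : forall j, (j < k)%nat -> Ioo (z j) /\ th (z j) = a j).
  { intros j. unfold z. destruct constructive_indefinite_description as [y Hy]. exact Hy. }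
  assert (Uniq : forall x y j, Ioo x -> Ioo y -> th x = a j -> th y = a j -> x = y).
  { intros x y j Hx Hy Ex' Ey. destruct (Rtotal_order x y) as [H|[H|H]]; [|assumption|].
    - pose proof (angle_crosses_upward s th rho x y (a j) Hs P (Ca j) (IO _ Hx) (IO _ Hy) H ltac:(lra)). lra.
    - pose proof (angle_crosses_upward s th rho y x (a j) Hs P (Ca j) (IO _ Hy) (IO _ Hx) H ltac:(lra)). lra. }
  exists (map z (seq 0 k)). split; [|split].
  - apply NoDup_map_NoDup_ForallPairs; [|apply seq_NoDup].
    intros i j Hi Hj E. apply in_seq in Hi, Hj.
    destruct (Hz i) as [_ Ei]; [lia|]. destruct (Hz j) as [_ Ej]; [lia|].
    rewrite E, Ej in Ei. unfold a in Ei. apply INR_eq. nra.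
  - now rewrite length_map, length_seq.
  - intros x. rewrite in_map_iff. split.
    + intros [j [<- Hj]]. apply in_seq in Hj. destruct (Hz j) as [H1 H2]; [lia|].
      split; [assumption|]. rewrite H2. apply Ca.
    + intros [Hx Hc]. destruct (cos_eq_0_0 _ Hc) as [n Hn].
      assert (L : -1 < x < 1) by exact Hx.
      assert (H1 : - (PI / 2) < th x).
      { apply (angle_crosses_upward s th rho (-1) x); auto; try lra.
        rewrite cos_neg. apply cos_PI2. }
      assert (H2 : th x < a k).
      { destruct (Rlt_le_dec (th x) (a k)) as [|H]; [assumption|exfalso].
        pose proof (angle_crosses_upward s th rho x 1 (a k) Hs P (Ca k) (IO _ Hx) Ip ltac:(lra) H).
        unfold a in H0. lra. }
      assert (Hn0 : (0 <= n)%Z).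
      { assert (-1 < n)%Z; [|lia]. apply lt_IZR. nra. }
      assert (En : INR (Z.to_nat n) = IZR n) by (rewrite INR_IZR_INZ, Z2Nat.id; auto).
      assert (Hlt : (Z.to_nat n < k)%nat).
      { apply INR_lt. rewrite En. unfold a in H2. nra. }
      exists (Z.to_nat n). split; [|apply in_seq; lia].
      destruct (Hz _ Hlt) as [H3 H4].
      apply (Uniq _ _ (Z.to_nat n)); auto. unfold a. rewrite Hn, En. ring.
Qed.

Lemma eigenmode_nonzero k s th rho :
  (1 <= k)%nat -> eigenmode k s th rho -> exists x, Icc x /\ mode th rho x <> 0.
Proof.
  intros Hk M. destruct (eigenmode_critical_points k s th rho Hk M) as [zs (_ & Hl & Hz)].
  destruct zs as [|z zs]; [simpl in Hl; lia|].
  destruct (proj1 (Hz z) (or_introl eq_refl)) as [Hi Hc].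
  exists z. split; [unfold Ioo in Hi; unfold Icc; lra|].
  unfold mode. apply Rmult_integral_contrapositive_currified.
  - apply Rgt_not_eq, exp_pos.
  - pose proof (sin2_cos2 (th z)) as E. unfold Rsqr in E. rewrite Hc in E. nra.
Qed.

Definition dmode (s : R) (th rho : R -> R) (x : R) : R := s * p x * (exp (rho x) * cos (th x)).

Lemma mode_derive s th rho x :
  pruefer s th rho -> Icc x -> is_derive (mode th rho) x (dmode s th rho x).
Proof.
  intros [Dt Dr] Hx. unfold mode. evar_last.
  - auto_derive; [|reflexivity]. repeat split; eexists; eauto.
  - rewrite (derive_eq th x _ (Dt x Hx)), (derive_eq rho x _ (Dr x Hx)).
    unfold dmode. ring.
Qed.

Lemma dmode_derive s th rho x :
  pruefer s th rho -> Icc x ->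
  is_derive (dmode s th rho) x (- (s ^ 2 * p x ^ 2 * mode th rho x)).
Proof.
  intros [Dt Dr] Hx. unfold dmode. evar_last.
  - auto_derive; [|reflexivity]. repeat split; eexists; eauto.
  - rewrite (derive_eq th x _ (Dt x Hx)), (derive_eq rho x _ (Dr x Hx)),
      (derive_eq p x _ (p_derive x)).
    pose proof (sin2_cos2 (th x)) as E. unfold Rsqr in E.
    assert (E' : sin (th x) ^ 2 = 1 - cos (th x) ^ 2) by lra.
    unfold mode. ring [E'].
Qed.

Lemma mode_continuous s th rho x : pruefer s th rho -> Icc x -> continuous (mode th rho) x.
Proof. intros P Hx. apply (is_derive_continuous _ _ _ (mode_derive s th rho x P Hx)). Qed.

Lemma mode_C2 s th rho :
  pruefer s th rho ->
  C2_Icc (mode th rho) (dmode s th rho) (fun x => - (s ^ 2 * p x ^ 2 * mode th rho x)).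
Proof.
  intros P. apply C2_of_is_derive.
  - intros x. now apply mode_derive.
  - intros x. now apply dmode_derive.
  - apply continuous_C0. intros x Hx.
    assert (Cp : continuous p x) by apply (is_derive_continuous _ _ _ (p_derive x)).
    apply (continuous_opp (V := R_NormedModule) (fun x => s ^ 2 * p x ^ 2 * mode th rho x)).
    apply (continuous_mult (K := R_AbsRing) (fun x => s ^ 2 * p x ^ 2));
      [|now apply (mode_continuous s)].
    apply (continuous_mult (K := R_AbsRing) (fun _ => s ^ 2) (fun x => p x ^ 2));
      [apply continuous_const|].
    apply (continuous_mult (K := R_AbsRing) p (fun x => p x ^ 1)); [assumption|].
    apply (continuous_mult (K := R_AbsRing) p (fun x => p x ^ 0)); [assumption|].
    apply continuous_const.
Qed.

(** * The inverse of the second derivative *)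

(** V^2 is convex, so |V| is bounded by its larger boundary value, which in turn
    is at most gamma times that bound. *)
Lemma convex_solution_zero (V V' V'' : R -> R) :
  (forall x, Icc x -> is_derive V x (V' x)) ->
  (forall x, Icc x -> is_derive V' x (V'' x)) ->
  (forall x, Icc x -> 0 <= V x * V'' x) ->
  (forall e, bc e V) -> forall x, Icc x -> V x = 0.
Proof.
  intros D D' Hc B.
  assert (D2 : forall x, Icc x -> is_derive (fun t => V t * V t) x (2 * (V x * V' x))).
  { intros x Hx. replace (2 * (V x * V' x)) with (V' x * V x + V x * V' x) by ring.
    apply (is_derive_mult V V); auto. intros; apply Rmult_comm. }
  assert (D3 : forall x, Icc x -> is_derive (fun t => 2 * (V t * V' t)) x
            (2 * (V' x * V' x + V x * V'' x))).
  { intros x Hx. apply (is_derive_scal (fun t => V t * V' t)).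
    apply (is_derive_mult V V'); auto. intros; apply Rmult_comm. }
  set (mx := Rmax (Rabs (V (-1))) (Rabs (V 1))).
  assert (Hend : forall e, Rabs (V (pmR e)) <= mx) by (intros [|]; [apply Rmax_l|apply Rmax_r]).
  assert (Hm : 0 <= mx) by (eapply Rle_trans; [apply Rabs_pos|apply (Hend Plus)]).
  assert (Hb : forall x, Icc x -> Rabs (V x) <= mx).
  { intros x Hx. destruct (Rle_lt_dec (Rabs (V x)) mx) as [|Hlt]; [assumption|exfalso].
    pose proof (Hend Minus) as H1. pose proof (Hend Plus) as H2. simpl in H1, H2.
    assert (G : forall y, Rabs (V y) <= mx -> V y * V y < V x * V x).
    { intros y Hy. rewrite <- (Rabs_pos_eq (V y * V y)), <- (Rabs_pos_eq (V x * V x)), !Rabs_mult by nra.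
      pose proof (Rabs_pos (V y)). nra. }
    assert (x <> -1) by (intros ->; lra). assert (x <> 1) by (intros ->; lra).
    unfold Icc in Hx.
    assert (I : forall y, -1 <= y <= 1 -> Icc y) by (intros; assumption).
    set (g := fun t => V t * V t) in *. set (g' := fun t => 2 * (V t * V' t)) in *.
    assert (MV : forall a b, -1 <= a -> a < b -> b <= 1 ->
      exists c, a <= c <= b /\ g b - g a = g' c * (b - a)).
    { intros a b Ha Hab Hb'. destruct (MVT_gen g a b g') as [c Hc'].
      - rewrite Rmin_left, Rmax_right by lra. intros t Ht. apply D2, I; lra.
      - rewrite Rmin_left, Rmax_right by lra. intros t Ht.
        apply continuity_pt_filterlim, (is_derive_continuous _ _ _ (D2 t (I t ltac:(lra)))).
      - rewrite Rmin_left, Rmax_right in Hc' by lra. now exists c. }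
    destruct (MV (-1) x) as [c1 [Hc1 E1]]; try lra.
    destruct (MV x 1) as [c2 [Hc2 E2]]; try lra.
    unfold g, g' in E1, E2.
    pose proof (G _ H1). pose proof (G _ H2).
    assert (0 < 2 * (V c1 * V' c1)) by nra.
    assert (2 * (V c2 * V' c2) < 0) by nra.
    destruct (MVT_gen (fun t => 2 * (V t * V' t)) c1 c2
      (fun x => 2 * (V' x * V' x + V x * V'' x))) as [c3 [Hc3 E3]].
    - rewrite Rmin_left, Rmax_right by lra. intros t Ht. apply D3, I. lra.
    - rewrite Rmin_left, Rmax_right by lra. intros t Ht.
      apply continuity_pt_filterlim.
      apply (is_derive_continuous (fun t => 2 * (V t * V' t)) t _ (D3 t (I t ltac:(lra)))).
    - rewrite Rmin_left, Rmax_right in Hc3 by lra.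
      pose proof (Hc c3 (I c3 ltac:(lra))). nra. }
  assert (mx <= gamma * mx).
  { assert (HB : forall e, Rabs (V (pmR e)) <= gamma * mx) by (intros e; now apply bc_estimate).
    unfold mx at 1. apply Rmax_lub; [apply (HB Minus)|apply (HB Plus)]. }
  pose proof gamma_le. assert (mx = 0) by nra.
  intros x Hx. specialize (Hb x Hx). apply Rabs_le_between in Hb. lra.
Qed.

Lemma defect_affine e g a b :
  defect e (fun x => g x + (a + b * x)) =
  defect e g + a * defect e (fun _ => 1) + b * defect e (fun x => x).
Proof.
  unfold defect.
  replace (sum_n_m (fun i => alpha e i * (g (eta e i) + (a + b * eta e i))) 1 (m e)) with
   (plus (sum_n_m (fun i => alpha e i * g (eta e i)) 1 (m e))
     (plus (mult a (sum_n_m (fun i => alpha e i * 1) 1 (m e)))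
           (mult b (sum_n_m (fun i => alpha e i * eta e i) 1 (m e))))).
  - unfold plus, mult; simpl. ring.
  - rewrite <- !(sum_n_m_mult_l (K := R_Ring)), <- !sum_n_m_plus.
    apply sum_n_m_ext_loc. intros i _. unfold plus, mult; simpl. ring.
Qed.

(** Correct a second primitive by an affine function a + b x.  The two boundary
    conditions are a linear system for a and b that is a small perturbation of
    the one for Dirichlet conditions. *)
Lemma poisson_solvable h :
  C0_Icc h -> exists u u', X_with m eta alpha u u' h.
Proof.
  intros Ch. pose proof (C0_clamp_continuous _ Ch) as C.
  set (g' := fun x => 0 + RInt (fun t => h (clamp t)) (-1) x).
  assert (Dg' : forall x, is_derive g' x (h (clamp x))).
  { intros x. apply (is_derive_primitive (fun t => h (clamp t))), C. }
  assert (Cg' : forall x, continuous g' x) by (intros x; apply (is_derive_continuous _ _ _ (Dg' x))).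
  set (g := fun x => 0 + RInt g' (-1) x).
  assert (Dg : forall x, is_derive g x (g' x)) by (intros x; now apply is_derive_primitive).
  pose proof gamma_le as Hg.
  assert (N1 : forall e, Rabs (defect e (fun _ => 1) - 1) <= 1 / 8).
  { intros e. unfold defect.
    replace (1 - sum_n_m (fun i => alpha e i * 1) 1 (m e) - 1)
      with (- sum_n_m (fun i => alpha e i * 1) 1 (m e)) by ring.
    rewrite Rabs_Ropp. apply Rle_trans with (gamma * 1); [|lra].
    apply (nonlocal_sum_bound e (fun _ => 1)). intros _ _. rewrite Rabs_R1. lra. }
  assert (Nx : forall e, Rabs (defect e (fun x => x) - pmR e) <= 1 / 8).
  { intros e. unfold defect.
    replace (pmR e - sum_n_m (fun i => alpha e i * eta e i) 1 (m e) - pmR e)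
      with (- sum_n_m (fun i => alpha e i * eta e i) 1 (m e)) by ring.
    rewrite Rabs_Ropp. apply Rle_trans with (gamma * 1); [|lra].
    apply (nonlocal_sum_bound e (fun x => x)). intros x Hx. apply Rabs_le, Hx. }
  pose proof (N1 Minus) as A1. pose proof (N1 Plus) as A2.
  pose proof (Nx Minus) as A3. pose proof (Nx Plus) as A4. simpl in A3, A4.
  apply Rabs_le_between in A1, A2, A3, A4.
  set (d1 := defect Minus (fun _ => 1)) in *. set (d2 := defect Plus (fun _ => 1)) in *.
  set (d3 := defect Minus (fun x => x)) in *. set (d4 := defect Plus (fun x => x)) in *.
  set (g1 := defect Minus g). set (g2 := defect Plus g).
  assert (Det : d1 * d4 - d2 * d3 <> 0).
  { assert (0 < d1 * d4) by (apply Rmult_lt_0_compat; lra).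
    assert (0 < d2 * - d3) by (apply Rmult_lt_0_compat; lra). lra. }
  (* Cramer's rule for a d1 + b d3 = - g1 and a d2 + b d4 = - g2 *)
  set (a := (d3 * g2 - d4 * g1) / (d1 * d4 - d2 * d3)).
  set (b := (d2 * g1 - d1 * g2) / (d1 * d4 - d2 * d3)).
  exists (fun x => g x + (a + b * x)), (fun x => g' x + b). split.
  - apply C2_of_is_derive; [| |assumption].
    + intros x _. apply (is_derive_plus (V := R_NormedModule)); [apply Dg|].
      auto_derive; [trivial|ring].
    + intros x Hx. evar_last.
      * apply (is_derive_plus (V := R_NormedModule)); [apply Dg'|apply (is_derive_const (V := R_NormedModule))].
      * rewrite clamp_id by assumption. apply plus_zero_r.
  - intros e. change (bc e (fun x => g x + (a + b * x))).
    apply defect_bc. rewrite defect_affine. destruct e.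
    + fold d1 d3 g1. unfold a, b. field. assumption.
    + fold d2 d4 g2. unfold a, b. field. assumption.
Qed.

Lemma Delta_inv_spec h :
  C0_Icc h -> exists u', X_with m eta alpha (Delta_inv m eta alpha h) u' h.
Proof.
  intros Ch. unfold Delta_inv. apply epsilon_spec. now apply poisson_solvable.
Qed.

Lemma Delta_inv_unique h (U U' : R -> R) :
  C0_Icc h -> (forall x, Icc x -> is_derive U x (U' x)) ->
  (forall x, Icc x -> is_derive U' x (h x)) -> (forall e, bc e U) ->
  forall x, Icc x -> Delta_inv m eta alpha h x = U x.
Proof.
  intros Ch DU DU' BU x Hx. destruct (Delta_inv_spec h Ch) as [u' [C2 B]].
  set (D := Delta_inv m eta alpha h) in *.
  destruct (C2_extension _ _ _ C2) as (W & W' & DW & DW' & EW).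
  assert (BW : forall e, bc e W).
  { intros e. apply bc_ext with D; [intros; symmetry; auto|apply B]. }
  rewrite <- EW by assumption.
  assert (W x - U x = 0); [|lra].
  apply (convex_solution_zero (fun t => W t - U t) (fun t => W' t - U' t)
           (fun t => h (clamp t) - h t)); auto.
  - intros t Ht. apply (is_derive_minus (V := R_NormedModule)); auto.
  - intros t Ht. apply (is_derive_minus (V := R_NormedModule)); auto.
  - intros t Ht. rewrite clamp_id by assumption. lra.
  - intros e. apply bc_ext with (fun t => 1 * W t + (-1) * U t); [intros; ring|].
    now apply bc_linear.
Qed.

(** * Spectrum and multiplicity *)

Section Spectrum.

Variable r : R -> R.
Hypothesis r_eq : forall x, Icc x -> r x = p x ^ 2.

Lemma r_C0 : C0_Icc r.
Proof.
  apply C0_ext with (fun x => p x * p x).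
  - intros x Hx. rewrite r_eq by assumption. ring.
  - assert (C0_Icc p).
    { apply continuous_C0. intros x _. apply (is_derive_continuous _ _ _ (p_derive x)). }
    now apply C0_mult.
Qed.

Lemma I_minus_K_C0 lambda y : C0_Icc y -> C0_Icc (I_minus_K m eta alpha r lambda y).
Proof.
  intros Cy. unfold I_minus_K, K_op. apply C0_minus_scal; [assumption|].
  destruct (Delta_inv_spec _ (C0_mult _ _ r_C0 Cy)) as [u' [[H _] _]].
  exact (is_derivative_C0 _ _ H).
Qed.

(** With D the inverse of the second derivative at r y, the hypothesis reads
    y = c u - lambda D; so y is of class C2, satisfies the boundary conditions
    and y'' = - lambda r (y + c u), the resonant equation. *)
Lemma I_minus_K_jordan k s th rho y c :
  (1 <= k)%nat -> eigenmode k s th rho -> C0_Icc y ->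
  (forall x, Icc x -> I_minus_K m eta alpha r (s ^ 2) y x = c * mode th rho x) ->
  c = 0 /\ exists a, forall x, Icc x -> y x = a * mode th rho x.
Proof.
  intros Hk M Cy H. assert (P : pruefer s th rho) by apply M.
  destruct (Delta_inv_spec _ (C0_mult _ _ r_C0 Cy)) as [u' [C2 B]].
  unfold I_minus_K, K_op in H.
  set (D := Delta_inv m eta alpha (fun t => r t * y t)) in *.
  destruct (C2_extension _ _ _ C2) as (W & W' & DW & DW' & EW).
  set (V := fun x => c * mode th rho x - s ^ 2 * W x).
  assert (EV : forall x, Icc x -> V x = y x).
  { intros x Hx. unfold V. rewrite <- H, EW by assumption. ring. }
  destruct (eigenmode_simple k s th rho V (fun x => c * dmode s th rho x - s ^ 2 * W' x) c Hk M)
    as [Hc [a Ha]].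
  - intros x Hx. apply (is_derive_minus (V := R_NormedModule)).
    + apply is_derive_scal. now apply mode_derive.
    + apply is_derive_scal, DW.
  - intros x Hx. evar_last.
    + apply (is_derive_minus (V := R_NormedModule)).
      * apply is_derive_scal. now apply dmode_derive.
      * apply is_derive_scal, DW'.
    + rewrite clamp_id, r_eq, EV by assumption. unfold minus, plus, opp; simpl. ring.
  - intros e. apply bc_ext with (fun x => c * mode th rho x + (- s ^ 2) * W x).
    + intros x _. unfold V. ring.
    + apply bc_linear; [eapply eigenmode_bc, M|].
      apply bc_ext with D; [intros; symmetry; auto|apply B].
  - split; [assumption|]. exists a. intros x Hx. rewrite <- EV by assumption. auto.
Qed.

Lemma I_minus_K_mode k s th rho x :
  (1 <= k)%nat -> eigenmode k s th rho -> Icc x ->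
  I_minus_K m eta alpha r (s ^ 2) (mode th rho) x = 0.
Proof.
  intros Hk M Hx. pose proof (eigenmode_pos _ _ _ _ Hk M) as Hs.
  assert (P : pruefer s th rho) by apply M.
  assert (Cm : C0_Icc (mode th rho)).
  { apply continuous_C0. intros t Ht. now apply (mode_continuous s). }
  unfold I_minus_K, K_op.
  rewrite (Delta_inv_unique (fun t => r t * mode th rho t) (fun t => - / s ^ 2 * mode th rho t)
             (fun t => - / s ^ 2 * dmode s th rho t)); auto.
  - field. lra.
  - apply C0_mult; [apply r_C0|assumption].
  - intros t Ht. apply is_derive_scal. now apply mode_derive.
  - intros t Ht. evar_last; [apply is_derive_scal; now apply dmode_derive|].
    rewrite r_eq by assumption. field. lra.
  - intros e. apply bc_scal. eapply eigenmode_bc, M.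
Qed.

Lemma iter_I_minus_K_C0 lambda l y :
  C0_Icc y -> C0_Icc (Nat.iter l (I_minus_K m eta alpha r lambda) y).
Proof. intros Cy. induction l as [|l IH]; [assumption|]. now apply I_minus_K_C0. Qed.

(** Whenever two successive applications give zero, the first already gives a
    multiple a u of the mode, and a = 0 since there is no Jordan chain; so the
    number of applications can be reduced to one. *)
Lemma generalized_nullspace_eigenmode k s th rho l y :
  (1 <= k)%nat -> eigenmode k s th rho -> C0_Icc y -> (1 <= l)%nat ->
  (forall x, Icc x -> Nat.iter l (I_minus_K m eta alpha r (s ^ 2)) y x = 0) ->
  exists a, forall x, Icc x -> y x = a * mode th rho x.
Proof.
  intros Hk M Cy. induction l as [|l IH]; [lia|]. intros _ H.
  set (f := I_minus_K m eta alpha r (s ^ 2)) in *.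
  destruct (I_minus_K_jordan k s th rho (Nat.iter l f y) 0 Hk M) as [_ [a Ha]].
  { now apply iter_I_minus_K_C0. }
  { intros x Hx. rewrite Rmult_0_l. now apply H. }
  destruct l as [|l]; [now exists a|].
  apply IH; [lia|]. intros x Hx.
  destruct (I_minus_K_jordan k s th rho (Nat.iter l f y) a Hk M) as [-> _].
  { now apply iter_I_minus_K_C0. }
  { exact Ha. }
  rewrite Ha by assumption. ring.
Qed.

Lemma eigenmode_algebraic_multiplicity k s th rho :
  (1 <= k)%nat -> eigenmode k s th rho -> algebraic_multiplicity m eta alpha r (s ^ 2) 1.
Proof.
  intros Hk M. assert (P : pruefer s th rho) by apply M.
  exists (fun _ => mode th rho). split; [|split].
  - intros _ _. split.
    + apply continuous_C0. intros t Ht. now apply (mode_continuous s).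
    + exists 1%nat. split; [lia|]. intros x Hx. now apply (I_minus_K_mode k s).
  - intros c H i Hi. replace i with 1%nat by lia.
    destruct (eigenmode_nonzero k s th rho Hk M) as [x [Hx Hn]].
    specialize (H x Hx). rewrite sum_n_n in H.
    apply Rmult_integral in H. tauto.
  - intros u [Cu [l [Hl H]]].
    destruct (generalized_nullspace_eigenmode k s th rho l u Hk M Cu Hl H) as [a Ha].
    exists (fun _ => a). intros x Hx. rewrite sum_n_n. auto.
Qed.

Lemma eigenmode_X k s th rho : eigenmode k s th rho ->
  X_with m eta alpha (mode th rho) (dmode s th rho) (fun x => - (s ^ 2 * p x ^ 2 * mode th rho x)).
Proof.
  intros M. split; [apply mode_C2, M|]. intros e. apply (eigenmode_bc k s th rho e M).
Qed.

Lemma eigenmode_eigenfunction k s th rho :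
  (1 <= k)%nat -> eigenmode k s th rho -> eigenfunction m eta alpha r (s ^ 2) (mode th rho).
Proof.
  intros Hk M. split; [|now apply (eigenmode_nonzero k s)].
  do 2 eexists. split; [apply (eigenmode_X k s th rho M)|].
  intros x Hx. rewrite r_eq by (unfold Ioo in Hx; unfold Icc; lra). ring.
Qed.

(** Condition (c) is Rolle's theorem for u', because u'' = - s^2 p^2 u. *)
Lemma eigenmode_T_set k s th rho :
  (1 <= k)%nat -> eigenmode k s th rho -> T_set m eta alpha k Plus (mode th rho).
Proof.
  intros Hk M. pose proof (eigenmode_pos _ _ _ _ Hk M) as Hs.
  assert (P : pruefer s th rho) by apply M.
  assert (IO : forall y, Ioo y -> Icc y) by (unfold Ioo, Icc; intros; lra).
  assert (Hp : forall x, Icc x -> 0 < p x) by (intros x Hx; pose proof (p_bounds x Hx); lra).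
  assert (Z : forall x, Icc x -> dmode s th rho x = 0 <-> cos (th x) = 0).
  { intros x Hx. pose proof (Hp x Hx). pose proof (exp_pos (rho x)). unfold dmode. split; intros H1.
    - apply Rmult_integral in H1 as [H1|H1]; [nra|].
      apply Rmult_integral in H1 as [H1|H1]; [lra|assumption].
    - rewrite H1. ring. }
  do 2 eexists. split; [apply (eigenmode_X k s th rho M)|]. split; [split|split; [split|]].
  - intros e. rewrite Z by apply Icc_pmR. intros H0.
    pose proof (cos_lower_bound _ (sin_end_small e s th rho P (eigenmode_bc k s th rho e M))) as H1.
    rewrite H0, Rabs_R0 in H1. lra.
  - destruct M as ((_ & _ & I) & _). apply Rabs_def2 in I.
    assert (Im : Icc (-1)) by (unfold Icc; lra).
    pose proof (Hp _ Im). pose proof (exp_pos (rho (-1))).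
    pose proof (cos_gt_0 (th (-1)) ltac:(lra) ltac:(lra)).
    simpl pmR. unfold dmode. rewrite Rmult_1_l.
    repeat apply Rmult_lt_0_compat; assumption.
  - intros x Hx H0. apply Z in H0; [|auto]. pose proof (Hp x (IO x Hx)).
    apply Ropp_neq_0_compat.
    repeat apply Rmult_integral_contrapositive_currified; try nra.
    + apply Rgt_not_eq, exp_pos.
    + pose proof (sin2_cos2 (th x)) as E. unfold Rsqr in E. rewrite H0 in E. nra.
  - destruct (eigenmode_critical_points k s th rho Hk M) as [zs (H1 & H2 & H3)].
    exists zs. split; [assumption|]. split; [assumption|].
    intros x. rewrite H3. split; intros [Hx H]; (split; [assumption|]); apply Z; auto.
  - intros x y Hx Hy Hxy Ex Ey _.
    destruct (MVT_cor2 (dmode s th rho) (fun x => - (s ^ 2 * p x ^ 2 * mode th rho x)) x y Hxy)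
      as [z [Hz Hi]].
    { intros t Ht. apply is_derive_Reals, dmode_derive; [assumption|].
      unfold Ioo, Icc in *; lra. }
    exists z. split; [assumption|]. rewrite Ex, Ey, Rminus_diag in Hz.
    assert (Iz : Icc z) by (unfold Ioo, Icc in *; lra).
    pose proof (Hp z Iz).
    symmetry in Hz. apply Rmult_integral in Hz as [Hz|Hz]; [|lra].
    assert (0 < s ^ 2 * p z ^ 2) by (apply Rmult_lt_0_compat; nra).
    apply Ropp_eq_0_compat in Hz. rewrite Ropp_involutive in Hz.
    apply Rmult_integral in Hz as [Hz|Hz]; [lra|assumption].
Qed.

Lemma eigenfunction_extension mu u :
  eigenfunction m eta alpha r mu u -> exists U U',
    (forall x, Icc x -> is_derive U x (U' x)) /\
    (forall x, Icc x -> is_derive U' x (- (mu * r x * U x))) /\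
    (forall e, bc e U) /\ exists x, Icc x /\ U x <> 0.
Proof.
  intros [(u' & u'' & [C2 B] & E) [x0 [Hx0 Hn]]].
  destruct (C2_extension _ _ _ C2) as (W & W' & DW & DW' & EW).
  destruct C2 as (D1 & _ & C0).
  assert (E' : forall x, Icc x -> u'' x = - mu * (r x * u x)).
  { apply C0_eq_of_interior; [assumption| |].
    - apply (C0_mult (fun _ => - mu) (fun x => r x * u x)).
      + apply continuous_C0. intros; apply continuous_const.
      + apply C0_mult; [apply r_C0|exact (is_derivative_C0 _ _ D1)].
    - intros x Hx. specialize (E x Hx). lra. }
  exists W, W'. split; [auto|]. split; [|split].
  - intros x Hx. replace (- (mu * r x * W x)) with (u'' (clamp x)); [auto|].
    rewrite clamp_id, E', EW by assumption. ring.
  - intros e. apply bc_ext with u; [intros; symmetry; auto|apply B].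
  - exists x0. rewrite EW by assumption. auto.
Qed.

(** Positive mu is s^2 with s = sqrt mu; for the other values V V'' >= 0. *)
Lemma spectrum_eigenmode mu :
  spectrum m eta alpha r mu ->
  exists k s th rho, (1 <= k)%nat /\ eigenmode k s th rho /\ mu = s ^ 2.
Proof.
  intros [u H]. destruct (eigenfunction_extension mu u H) as (U & U' & D & D' & B & x0 & Hx0 & Hn).
  destruct (Rlt_le_dec 0 mu) as [Hmu|Hmu].
  - assert (Es : sqrt mu ^ 2 = mu) by (rewrite <- Rsqr_pow2; apply Rsqr_sqrt; lra).
    destruct (eigensolution_is_mode (sqrt mu) U U') as (k & th & rho & Hk & M); auto.
    + now apply sqrt_lt_R0.
    + intros x Hx. rewrite Es, <- r_eq by assumption. auto.
    + now exists x0.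
    + exists k, (sqrt mu), th, rho. auto.
  - exfalso. apply Hn.
    apply (convex_solution_zero U U' (fun x => - (mu * r x * U x))); auto.
    intros x Hx. rewrite r_eq by assumption.
    replace (U x * - (mu * p x ^ 2 * U x)) with (- mu * (p x * U x) ^ 2) by ring.
    apply Rmult_le_pos; [lra|apply pow2_ge_0].
Qed.

Lemma eigenvalue_sequence :
  exists lambda : nat -> R,
    (forall k, (1 <= k)%nat -> 0 < lambda k) /\
    (forall k, (1 <= k)%nat -> lambda k < lambda (S k)) /\
    (forall mu : R, spectrum m eta alpha r mu <->
       exists k, (1 <= k)%nat /\ mu = lambda k) /\
    (forall k, (1 <= k)%nat -> simple_eigenvalue m eta alpha r (lambda k)) /\
    (forall k, (1 <= k)%nat ->
       exists u, eigenfunction m eta alpha r (lambda k) u /\ T_set m eta alpha k Plus u) /\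
    is_lim_seq lambda p_infty.
Proof.
  set (S := fun k => proj1_sig (constructive_indefinite_description _ (eigenmode_exists k))).
  assert (HS : forall k, eigenmode k (fst (S k)) (fst (snd (S k))) (snd (snd (S k)))).
  { intros k. unfold S. destruct constructive_indefinite_description as [y Hy]. exact Hy. }
  set (sk := fun k => fst (S k)).
  set (u := fun k => mode (fst (snd (S k))) (snd (snd (S k)))).
  assert (Pos : forall k, (1 <= k)%nat -> 0 < sk k).
  { intros k Hk. apply (eigenmode_pos k _ _ _ Hk (HS k)). }
  assert (Eig : forall k, (1 <= k)%nat -> eigenfunction m eta alpha r (sk k ^ 2) (u k)).
  { intros k Hk. apply (eigenmode_eigenfunction k _ _ _ Hk (HS k)). }
  exists (fun k => sk k ^ 2). split; [|split; [|split; [|split; [|split]]]].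
  - intros k Hk. specialize (Pos k Hk). nra.
  - intros k Hk. pose proof (Pos k Hk).
    assert (sk k < sk (Datatypes.S k)).
    { apply (eigenmode_increasing k (Datatypes.S k) _ _ _ _ _ _ ltac:(lia) (HS k) (HS (Datatypes.S k))). }
    nra.
  - intros mu. split.
    + intros H. destruct (spectrum_eigenmode mu H) as (k & s & th & rho & Hk & M & ->).
      exists k. split; [assumption|]. f_equal. apply (eigenmode_unique k _ _ _ _ _ _ M (HS k)).
    + intros [k [Hk ->]]. exists (u k). auto.
  - intros k Hk. split; [exists (u k); auto|].
    apply (eigenmode_algebraic_multiplicity k _ _ _ Hk (HS k)).
  - intros k Hk. exists (u k). split; [auto|]. apply (eigenmode_T_set k _ _ _ Hk (HS k)).
  - apply is_lim_seq_spec. intros M.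
    set (L := growth * (gain + p1)).
    assert (HL : 0 < L).
    { apply Rmult_lt_0_compat; [pose proof growth_ge1; lra|].
      pose proof gain_pos. pose proof p1_pos. lra. }
    (* s_k > |M| + 1 for k > N, whence s_k^2 > M *)
    destruct (nfloor_ex (L * (Rabs M + 1) + 1)) as [N [_ HN]].
    { pose proof (Rabs_pos M). nra. }
    exists (Datatypes.S N). intros k Hk.
    assert (H1 : (1 <= k)%nat) by lia.
    pose proof (eigenmode_growth k _ _ _ H1 (HS k)) as HG. fold L (sk k) in HG.
    apply le_INR in Hk. rewrite S_INR in Hk.
    pose proof PI2_3_2 as Hpi. pose proof (pos_INR N).
    assert (HPI : 1 * (INR k - / 2) <= PI * (INR k - / 2)) by (apply Rmult_le_compat_r; lra).
    pose proof (Rabs_pos M). pose proof (Rle_abs M).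
    assert (L * (Rabs M + 1) < L * sk k) by lra.
    assert (Rabs M + 1 < sk k) by (apply Rmult_lt_reg_l with L; assumption).
    nra.
Qed.

End Spectrum.

End BoundaryConditions.
End Weight.

(** * The weight as a square *)

(** Take p = sqrt (r (-1)) exp (I) with I the primitive of q = r' / (2 r), half the
    logarithmic derivative of r.  Unlike sqrt r, this is positive and differentiable
    on the whole line. *)
Lemma weight_square r :
  C1_Icc r -> (forall x, Icc x -> 0 < r x) ->
  exists (p q : R -> R) (p0 p1 Q : R),
    0 < p0 /\ (forall x, Icc x -> p0 <= p x <= p1) /\
    (forall x, is_derive p x (q x * p x)) /\ (forall x, continuous q x) /\
    (forall x, Icc x -> Rabs (q x) <= Q) /\ (forall x, Icc x -> r x = p x ^ 2).
Proof.
  intros [r' [D C]] Hr.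
  assert (Im : Icc (-1)) by (unfold Icc; lra).
  set (q := fun x => r' (clamp x) / (2 * r (clamp x))).
  assert (Cq : forall x, continuous q x).
  { intros x. apply (continuous_mult (K := R_AbsRing) (fun t => r' (clamp t)) (fun t => / (2 * r (clamp t)))).
    - now apply C0_clamp_continuous.
    - apply (continuous_comp (fun t => 2 * r (clamp t)) Rinv).
      + apply (continuous_mult (K := R_AbsRing)); [apply continuous_const|].
        apply C0_clamp_continuous, (is_derivative_C0 _ _ D).
      + apply continuous_Rinv. pose proof (Hr _ (clamp_Icc x)). lra. }
  destruct (C0_bounded q) as [Q [HQ Bq]]; [apply continuous_C0; auto|].
  set (I := fun x => 0 + RInt q (-1) x).
  assert (DI : forall x, is_derive I x (q x)) by (intros x; now apply is_derive_primitive).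
  assert (I0 : I (-1) = 0) by apply primitive_at.
  set (p := fun x => sqrt (r (-1)) * exp (I x)).
  assert (Hs : 0 < sqrt (r (-1))) by (apply sqrt_lt_R0; auto).
  exists p, q, (sqrt (r (-1)) * exp (- (2 * Q))), (sqrt (r (-1)) * exp (2 * Q)), Q.
  split; [|split; [|split; [|split; [|split]]]]; try assumption.
  - apply Rmult_lt_0_compat; [assumption|apply exp_pos].
  - intros x Hx. unfold p.
    assert (HI : Rabs (I x - I (-1)) <= Q * Rabs (x - -1)) by (apply (lipschitz_Icc I q); auto).
    rewrite I0, Rminus_0_r, (Rabs_pos_eq (x - -1)) in HI by (unfold Icc in Hx; lra).
    apply Rabs_le_between in HI. unfold Icc in Hx.
    split; (apply Rmult_le_compat_l; [lra|]; apply exp_le_mono; nra).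
  - intros x. unfold p. evar_last.
    + apply is_derive_scal. apply (is_derive_comp exp I); [|apply DI].
      apply is_derive_Reals, derivable_pt_lim_exp.
    + unfold scal; simpl. unfold mult; simpl. ring.
  - set (rt := fun x => r (-1) + RInt (fun t => r' (clamp t)) (-1) x).
    assert (Ert : forall x, Icc x -> r x = rt x) by (intros; now apply primitive_of_derivative).
    assert (Drt : forall x, is_derive rt x (r' (clamp x))).
    { intros x. apply (is_derive_primitive (fun t => r' (clamp t))). now apply C0_clamp_continuous. }
    assert (DE : forall x, is_derive (fun t => exp (- (2 * I t))) x (- (2 * q x) * exp (- (2 * I x)))).
    { intros x. evar_last.
      - auto_derive; [|reflexivity]. eexists; apply DI.
      - rewrite (derive_eq I x _ (DI x)). ring. }
    assert (DP : forall x, is_derive (fun t => rt t * exp (- (2 * I t))) x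
        (r' (clamp x) * exp (- (2 * I x)) + rt x * (- (2 * q x) * exp (- (2 * I x))))).
    { intros x. apply (is_derive_mult rt (fun t => exp (- (2 * I t)))); auto.
      intros; apply Rmult_comm. }
    intros x Hx.
    (* r and exp (2 I) have the same logarithmic derivative 2 q *)
    assert (E : rt x * exp (- (2 * I x)) = r (-1)).
    { apply (eq_of_derivative (fun t => rt t * exp (- (2 * I t))) (fun _ => r (-1))
        (fun x => r' (clamp x) * exp (- (2 * I x)) + rt x * (- (2 * q x) * exp (- (2 * I x))))
        (fun _ => 0)); auto.
      - intros t. apply (is_derive_continuous _ _ _ (DP t)).
      - intros t. apply continuous_const.
      - intros t _. apply (is_derive_const (V := R_NormedModule)).
      - intros t Ht. assert (It : Icc t) by (unfold Ioo in Ht; unfold Icc; lra).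
        unfold q. rewrite clamp_id, <- Ert by assumption. pose proof (Hr t It). field. lra.
      - rewrite I0, Rmult_0_r, Ropp_0, exp_0, <- Ert by assumption. ring. }
    rewrite Ert by assumption. unfold p.
    replace ((sqrt (r (-1)) * exp (I x)) ^ 2) with
      (sqrt (r (-1)) * sqrt (r (-1)) * (exp (I x) * exp (I x))) by ring.
    rewrite sqrt_sqrt, <- E by (left; auto).
    rewrite Rmult_assoc, <- !exp_plus.
    replace (- (2 * I x) + (I x + I x)) with 0 by ring. rewrite exp_0. ring.
Qed.

Theorem theorem1p1 (m : pm -> nat) (eta : pm -> nat -> R)
    (m_ge1 : forall s, (1 <= m s)%nat) (eta_adm : admissible_points m eta)
    (r : R -> R) (r_C1 : C1_Icc r) (r_pos : forall x, Icc x -> 0 < r x) :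
  exists gamma : R, 0 < gamma <= 1 /\
    forall alpha : pm -> nat -> R, calA m gamma alpha ->
      exists lambda : nat -> R,
        (forall k, (1 <= k)%nat -> 0 < lambda k) /\
        (forall k, (1 <= k)%nat -> lambda k < lambda (S k)) /\
        (forall mu : R, spectrum m eta alpha r mu <->
           exists k, (1 <= k)%nat /\ mu = lambda k) /\
        (forall k, (1 <= k)%nat ->
           simple_eigenvalue m eta alpha r (lambda k)) /\
        (forall k, (1 <= k)%nat ->
           exists u, eigenfunction m eta alpha r (lambda k) u /\
                     T_set m eta alpha k Plus u) /\
        is_lim_seq lambda p_infty.
Proof.
  destruct (weight_square r r_C1 r_pos) as (p & q & p0 & p1 & Q & H0 & Hp & Dp & Cq & Bq & Er).
  pose proof (threshold_pos p q p0 p1 Q H0 Hp Bq) as Hpos.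
  exists (threshold p0 p1 Q). split.
  - split; [assumption|].
    pose proof (threshold_cost_le p q p0 p1 Q H0 Hp Bq).
    pose proof (cost_ge1 q Q Bq). nra.
  - intros alpha Halpha.
    apply (eigenvalue_sequence p q p0 p1 Q H0 Hp Dp Cq Bq m eta alpha (threshold p0 p1 Q)).
    + intros s i Hi. apply (eta_adm s i Hi).
    + intros s. left. apply Halpha.
    + lra.
    + assumption.
Qed.
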